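(* Let $(\mathcal L,(\cdot,\cdot),\mathcal H)\in\mathcal T$ and let $\dot{\mathfrak g}$ be the subalgebra of $\mathcal L_c$ generated by $\{e_{\pm\dot\alpha_i}\}_{i=1}^\ell$ (notation as in the context). Then $\dot{\mathfrak g}$ is a finite-dimensional split simple Lie subalgebra of $\mathcal L_c$ with root system $\dot R_{red}$ and splitting Cartan subalgebra $\dot{\mathfrak h}=\bigoplus_{i=1}^\ell\mathbb F h_{\dot\alpha_i}$.
   Context: $\mathbb F$ is a field of characteristic $0$. If $V$ is a finite-dimensional space with a non-degenerate symmetric bilinear form and $\alpha\in V^\star$, $t_\alpha$ denotes the unique element of $V$ with $(t_\alpha,v)=\alpha(v)$ for all $v\in V$. A nonzero subalgebra $\mathcal H$ of a Lie algebra $\mathcal L$ is a (split) toral subalgebra if $\mathcal L=\bigoplus_{\alpha\in\mathcal H^\star}\mathcal L_\alpha$, where $\mathcal L_\alpha=\{x\in\mathcal L:[h,x]=\alpha(h)x\ \forall h\in\mathcal H\}$. The class $\mathcal T$ consists of triples $(\mathcal L,(\cdot,\cdot),\mathcal H)$ with: (T1) $\mathcal L$ is a Lie algebra over $\mathbb F$ with a non-degenerate symmetric invariant bilinear form $(\cdot,\cdot)$; (T2) $\mathcal H$ is a finite-dimensional toral subalgebra of $\mathcal L$ and $(\cdot,\cdot)|_{\mathcal H\times\mathcal H}$ is non-degenerate. Put $R=\{\alpha\in\mathcal H^\star:\mathcal L_\alpha\neq0\}$ (root system), transfer the form to $\mathcal H^\star$ by $(\alpha,\beta):=(t_\alpha,t_\beta)$,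 and let $R^\times=\{\alpha\in R:(\alpha,\alpha)\ne0\}$, $R^0=\{\alpha\in R:(\alpha,\alpha)=0\}$; (T3) for each $\delta\in R^0$ there are $x\in\mathcal L_\delta$, $y\in\mathcal L_{-\delta}$ with $[x,y]=t_\delta$, and for each $\alpha\in R^\times$ and each $0\ne x\in\mathcal L_\alpha$ there is $y\in\mathcal L_{-\alpha}$ with $[x,y]=t_\alpha$; (T4) for $\alpha\in R^\times$ and $x\in\mathcal L_\alpha$, $\mathrm{ad}\,x$ acts locally nilpotently on $\mathcal L$; (T5) (a) $R^\times$ is not a disjoint union of two nonempty mutually orthogonal subsets, (b) for each $\delta\in R^0$ there is $\alpha\in R^\times$ with $\alpha+\delta\in R$; (T6) $\Lambda:=\mathrm{span}_{\mathbb Z}(R^0)$ is a free abelian group of finite rank. The core $\mathcal L_c$ is the subalgebra generated by the $\mathcal L_\alpha$, $\alpha\in R^\times$. A finite root system is a subset $\Delta$ containing $0$ with $\Delta^\times:=\Delta\setminus\{0\}$ a finite root system in the sense of Bourbaki; $\Delta_{red}=\{0\}\cup\{\alpha\in\Delta:\alpha/2\notin\Delta\}$. Standard setup: normalize the form so that $(\alpha_0,\alpha_0)=1$ for some $\alpha_0\in R^\times$; then $(R,R)\subseteq\mathbb Q$. Let $\mathcal V=\mathbb R\otimes_{\mathbb Q}\mathrm{span}_{\mathbb Q}(R)$ with the induced real positive semidefinite form, $\mathcal V^0$ its radical, and $\bar{\ }:\mathcal V\to\mathcal V/\mathcal V^0$. The image $\bar R$ is an irreducible finite root system; fix a base $\{\bar\alpha_1,\dots,\bar\alpha_\ell\}$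 of $\bar R$ and preimages $\dot\alpha_i\in R$ of $\bar\alpha_i$. With $\dot{\mathcal V}=\mathrm{span}_{\mathbb R}\{\dot\alpha_i\}$ one has $\mathcal V=\dot{\mathcal V}\oplus\mathcal V^0$, $R^0=R\cap\mathcal V^0$, and $\dot R:=\{\dot\alpha\in\dot{\mathcal V}:\dot\alpha+\delta\in R\text{ for some }\delta\in\mathcal V^0\}$ is an irreducible finite root system with base $\{\dot\alpha_1,\dots,\dot\alpha_\ell\}$, isomorphic to $\bar R$, with $\dot R\subseteq\mathrm{span}_{\mathbb Z}\{\dot\alpha_i\}\subseteq\mathcal H^\star$ and $\dot R_{red}\subseteq R$. For $\alpha\in R^\times$ let $h_\alpha=2t_\alpha/(t_\alpha,t_\alpha)$. For each $i$ fix $e_{\pm\dot\alpha_i}\in\mathcal L_{\pm\dot\alpha_i}$ with $[h_{\dot\alpha_i},e_{\pm\dot\alpha_i}]=\pm2e_{\pm\dot\alpha_i}$, $[e_{\dot\alpha_i},e_{-\dot\alpha_i}]=h_{\dot\alpha_i}$ (possible by (T3)). *)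

(* Defs.v *)
(* Lie algebras are not in the library: the needed notions are
   defined below, following the paper.  Subsets of L are Prop-predicates;
   elements of H^* are modelled as functions L -> F that are linear on H
   (only their values on H matter in every definition below). *)
From HB Require Import structures.
From mathcomp Require Import all_boot all_order all_algebra.
From Stdlib Require Import ClassicalEpsilon.
From Stdlib Require List.
Set Implicit Arguments. Unset Strict Implicit. Unset Printing Implicit Defensive.
Import Order.TTheory GRing.Theory Num.Theory.
Local Open Scope ring_scope.

Section LieDefs.
Context {F : fieldType} {L : lmodType F}.
Implicit Types (br : L -> L -> L) (form : L -> L -> F) (A K H I : L -> Prop).

Definition lie_bracket br : Prop :=
  (forall a x y z, br (a *: x + y) z = a *: br x z + br y z) /\
  (forall a x y z, br z (a *: x + y) = a *: br z x + br z y) /\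
  (forall x, br x x = 0) /\
  (forall x y z, br x (br y z) + br y (br z x) + br z (br x y) = 0).

Definition subspace A : Prop :=
  A 0 /\ (forall a x y, A x -> A y -> A (a *: x + y)).

Definition subalgebra br A : Prop :=
  subspace A /\ (forall x y, A x -> A y -> A (br x y)).

Definition gen_subalg br (S : L -> Prop) : L -> Prop :=
  fun x => forall K, subalgebra br K -> (forall y, S y -> K y) -> K x.

Definition fin_dim A : Prop :=
  exists s : seq L, (forall x, List.In x s -> A x) /\
    (forall x, A x -> exists c : 'I_(size s) -> F,
        x = \sum_(i < size s) c i *: nth 0 s i).

Definition ideal br A I : Prop :=
  subspace I /\ (forall x, I x -> A x) /\
  (forall x y, A x -> I y -> I (br x y)).

Definition simple_lie br A : Prop :=
  subalgebra br A /\ (exists x y, A x /\ A y /\ br x y <> 0) /\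
  (forall I, ideal br A I -> (forall x, I x -> x = 0) \/ (forall x, A x -> I x)).

Definition wsp br K A (beta : L -> F) (x : L) : Prop :=
  A x /\ (forall h, K h -> br h x = beta h *: x).

Definition weight_decomp br K A : Prop :=
  forall x, A x -> exists s : seq ((L -> F) * L),
    (forall p, List.In p s -> wsp br K A p.1 p.2) /\ x = \sum_(p <- s) p.2.

Definition toral br K A : Prop :=
  subalgebra br K /\ (forall x, K x -> A x) /\ (exists h, K h /\ h <> 0) /\
  weight_decomp br K A.

Definition nilpotent_sub br K : Prop :=
  exists n : nat, forall (x : L) (xs : seq L), size xs = n ->
    K x -> (forall y, List.In y xs -> K y) -> foldr br x xs = 0.

Definition self_normalizing br K A : Prop :=
  forall x, A x -> (forall h, K h -> K (br x h)) -> K x.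

Definition splitting_cartan br K A : Prop :=
  toral br K A /\ nilpotent_sub br K /\ self_normalizing br K A.

Definition invariant_form br form : Prop :=
  (forall a x y z, form (a *: x + y) z = a * form x z + form y z) /\
  (forall x y, form x y = form y x) /\
  (forall x y z, form (br x y) z = form x (br y z)).

Definition nondeg_on form K : Prop :=
  forall x, K x -> (forall y, K y -> form x y = 0) -> x = 0.

Definition lin_on K (alpha : L -> F) : Prop :=
  forall a x y, K x -> K y -> alpha (a *: x + y) = a * alpha x + alpha y.

Definition tvec form H (alpha : L -> F) : L :=
  epsilon (inhabits (0 : L))
    (fun t => H t /\ forall h, H h -> form t h = alpha h).

Definition rform form H (alpha beta : L -> F) : F :=
  form (tvec form H alpha) (tvec form H beta).

Definition is_root br H (alpha : L -> F) : Prop :=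
  lin_on H alpha /\ exists x, x <> 0 /\ wsp br H (fun _ => True) alpha x.

Definition Rx br form H alpha : Prop :=
  is_root br H alpha /\ rform form H alpha alpha <> 0.
Definition R0 br form H alpha : Prop :=
  is_root br H alpha /\ rform form H alpha alpha = 0.

Definition hcor form H (alpha : L -> F) : L :=
  (2 / rform form H alpha alpha) *: tvec form H alpha.

Definition core br form H : L -> Prop :=
  gen_subalg br (fun x => exists alpha, Rx br form H alpha /\
                                        wsp br H (fun _ => True) alpha x).

Definition in_Lambda br form H (beta : L -> F) : Prop :=
  exists s : seq (int * (L -> F)), (forall p, List.In p s -> R0 br form H p.2) /\
    forall h, H h -> beta h = \sum_(p <- s) p.1%:~R * p.2 h.

Definition class_T br form H : Prop :=
  [pchar F] =i pred0 /\
  lie_bracket br /\ invariant_form br form /\ nondeg_on form (fun _ => True) /\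
  toral br H (fun _ => True) /\ fin_dim H /\ nondeg_on form H /\
  (forall delta, R0 br form H delta -> exists x y,
      wsp br H (fun _ => True) delta x /\
      wsp br H (fun _ => True) (fun z => - delta z) y /\
      br x y = tvec form H delta) /\
  (forall alpha, Rx br form H alpha -> forall x,
      wsp br H (fun _ => True) alpha x -> x <> 0 -> exists y,
      wsp br H (fun _ => True) (fun z => - alpha z) y /\
      br x y = tvec form H alpha) /\
  (forall alpha x, Rx br form H alpha -> wsp br H (fun _ => True) alpha x ->
      forall y, exists n : nat, iter n (br x) y = 0) /\
  (forall P Q : (L -> F) -> Prop,
      (forall a, Rx br form H a <-> P a \/ Q a) ->
      (forall a, ~ (P a /\ Q a)) ->
      (exists a, P a) -> (exists b, Q b) ->
      ~ (forall a b, P a -> Q b -> rform form H a b = 0)) /\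
  (forall delta, R0 br form H delta -> exists alpha, Rx br form H alpha /\
      is_root br H (fun z => alpha z + delta z)) /\
  (* T6 : Lambda is free abelian of finite rank (has a finite Z-basis) *)
  (exists (n : nat) (b : 'I_n -> L -> F),
      (forall i, in_Lambda br form H (b i)) /\
      (forall delta, R0 br form H delta -> exists k : 'I_n -> int,
          forall h, H h -> delta h = \sum_(i < n) (k i)%:~R * b i h) /\
      (forall k : 'I_n -> int,
          (forall h, H h -> \sum_(i < n) (k i)%:~R * b i h = 0) ->
          forall i, k i = 0)).

(* alpha lies in the radical V^0 of the form on V = R (x)_Q span_Q R *)
Definition orth_roots br form H (alpha : L -> F) : Prop :=
  forall rho, is_root br H rho -> rform form H alpha rho = 0.

(* the images of ad i in  R-bar  form a base of the finite root system R-bar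
   (Bourbaki): linearly independent in V/V^0, and every root is, modulo V^0,
   an integral combination with coefficients all >= 0 or all <= 0. *)
Definition std_base br form H (l : nat) (ad : 'I_l -> L -> F) : Prop :=
  (forall i, is_root br H (ad i)) /\
  (forall c : 'I_l -> rat,
      orth_roots br form H (fun x => \sum_(i < l) ratr (c i) * ad i x) ->
      forall i, c i = 0) /\
  (forall alpha, is_root br H alpha -> exists k : 'I_l -> int,
      ((forall i, 0 <= k i) \/ (forall i, k i <= 0)) /\
      orth_roots br form H (fun x => alpha x - \sum_(i < l) (k i)%:~R * ad i x)).

(* alpha in R-dot: alpha in V-dot and alpha + delta in R for some delta in V^0 *)
Definition in_Rdot br form H (l : nat) (ad : 'I_l -> L -> F) (alpha : L -> F)
  : Prop :=
  (exists c : 'I_l -> rat,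
      forall h, H h -> alpha h = \sum_(i < l) ratr (c i) * ad i h) /\
  (exists beta, is_root br H beta /\
      orth_roots br form H (fun x => beta x - alpha x)).

Definition in_Rdot_red br form H (l : nat) (ad : 'I_l -> L -> F)
  (alpha : L -> F) : Prop :=
  (forall h, H h -> alpha h = 0) \/
  (in_Rdot br form H ad alpha /\ ~ in_Rdot br form H ad (fun x => alpha x / 2)).

Definition std_e br form H (l : nat) (ad : 'I_l -> L -> F) (ep em : 'I_l -> L)
  : Prop :=
  forall i,
    wsp br H (fun _ => True) (ad i) (ep i) /\
    wsp br H (fun _ => True) (fun z => - ad i z) (em i) /\
    br (hcor form H (ad i)) (ep i) = 2 *: ep i /\
    br (hcor form H (ad i)) (em i) = - (2 *: em i) /\
    br (ep i) (em i) = hcor form H (ad i).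

End LieDefs.

(* Main.v *)
(* Weights of H are represented by the vectors t_alpha of H.  Neither L_0 = H nor
   dim L_alpha = 1 is available in the class T, and the Serre relations are not used.

   Isotropic roots are orthogonal to all roots: otherwise the Heisenberg algebra of an
   isotropic root d would produce, from a nonisotropic root a, a root a + 3d or a - 3d
   whose Cartan integer against a is not integral.  Integrality of the Cartan numbers along
   the root string b, b + a, b + 2a, ... bounds every Cartan integer <b, a^vee> by 6 in
   absolute value.  Hence the image Phi of the nonisotropic roots in the lattice Z^l spanned
   by the base is finite, its canonical form sum_k <x, k^vee><y, k^vee> is positive and
   reflection invariant, and every element of Phi is conjugate under the simple
   reflections to m alpha_i with m = 1, -1, 2 or -2.

   The triangular decomposition of the generated algebra g gives its components of weight
   m alpha_i: they are spanned by e_i or f_i for m = 1, -1 and vanish for |m| > 1.  Powers of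
   ad e_i and ad f_i carry weight spaces injectively to the reflected ones (sl_2 theory),
   which transfers this to all of Phi: weight spaces of g are at most lines, the weights of g
   are 0 and the elements of Phi that are not doubles, and a nonzero ideal contains some h_i,
   hence all of them because the base is connected. *)
Require Import Defs.
From HB Require Import structures.
From mathcomp Require Import all_boot all_order all_algebra.
From mathcomp Require Import zify ring.
From Stdlib Require Import Classical ClassicalEpsilon.
From Stdlib Require List.
Set Implicit Arguments. Unset Strict Implicit. Unset Printing Implicit Defensive.
Import Order.TTheory GRing.Theory Num.Theory.
Local Open Scope ring_scope.

(** * Brackets and sl_2-triples *)

Section CharZero.
Variable F : fieldType.
Hypothesis char0 : [pchar F] =i pred0.

Lemma natF_eq0 (n : nat) : (n%:R == 0 :> F) = (n == 0%N).
Proof. exact: (pcharf0P F).1. Qed.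

Lemma intF_eq0 (n : int) : (n%:~R == 0 :> F) = (n == 0).
Proof. by case: n => n; rewrite ?NegzE ?rmorphN ?oppr_eq0 /= natF_eq0. Qed.

Lemma intF_inj : injective (fun n : int => n%:~R : F).
Proof. by move=> m n /eqP; rewrite -subr_eq0 -rmorphB /= intF_eq0 subr_eq0 => /eqP. Qed.

Lemma twoF_neq0 : (2 : F) != 0.
Proof. by rewrite natF_eq0. Qed.

End CharZero.

Section Lie.
Variables (F : fieldType) (L : lmodType F) (br : L -> L -> L).
Hypothesis lieP : lie_bracket br.
Implicit Types (x y z v w e f h : L) (a c : F) (k n : nat).

Lemma brDl x y z : br (x + y) z = br x z + br y z.
Proof. by case: lieP => H _; have := H 1 x y z; rewrite !scale1r. Qed.

Lemma brDr x y z : br z (x + y) = br z x + br z y.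
Proof. by case: lieP => _ [H _]; have := H 1 x y z; rewrite !scale1r. Qed.

Lemma br0l z : br 0 z = 0.
Proof. by apply: (addIr (br 0 z)); rewrite -brDl !add0r. Qed.

Lemma br0r z : br z 0 = 0.
Proof. by apply: (addIr (br z 0)); rewrite -brDr !add0r. Qed.

Lemma brZl a x z : br (a *: x) z = a *: br x z.
Proof. by case: lieP => H _; have := H a x 0 z; rewrite !addr0 br0l addr0. Qed.

Lemma brZr a x z : br z (a *: x) = a *: br z x.
Proof. by case: lieP => _ [H _]; have := H a x 0 z; rewrite !addr0 br0r addr0. Qed.

Lemma brNl x z : br (- x) z = - br x z.
Proof. by rewrite -scaleN1r brZl scaleN1r. Qed.

Lemma brNr x z : br z (- x) = - br z x.
Proof. by rewrite -scaleN1r brZr scaleN1r. Qed.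

Lemma brC x y : br x y = - br y x.
Proof.
case: lieP => _ [_ [H _]]; apply/eqP; rewrite -addr_eq0.
by have := H (x + y); rewrite brDl !brDr !H add0r addr0 => ->.
Qed.

Lemma brxx x : br x x = 0.
Proof. by case: lieP => _ [_ [H _]]. Qed.

Lemma brJ x y z : br x (br y z) = br (br x y) z + br y (br x z).
Proof.
case: lieP => _ [_ [_ H]]; apply/eqP; rewrite -subr_eq0 -(H x y z).
by rewrite (brC z (br x y)) (brC z x) brNr opprD addrA addrAC.
Qed.

Lemma br_sumr (I : Type) (s : seq I) (P : pred I) (E : I -> L) x :
  br x (\sum_(i <- s | P i) E i) = \sum_(i <- s | P i) br x (E i).
Proof. by apply: (big_morph (br x)) => [y z|]; rewrite ?brDr ?br0r. Qed.

Lemma iter_br0 x k : iter k (br x) 0 = 0.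
Proof. by elim: k => //= k ->; rewrite br0r. Qed.

Definition sl2_triple e f h : Prop :=
  [/\ br h e = 2 *: e, br h f = - (2 *: f) & br e f = h].

Definition nilp_at x v : Prop := exists n, iter n (br x) v = 0.

Lemma sl2_tripleC e f h : sl2_triple e f h -> sl2_triple f e (- h).
Proof.
by case=> he hf ef; split; rewrite ?brNl ?he ?hf ?opprK // brC ef.
Qed.

Lemma nilp_at_last x v : v <> 0 -> nilp_at x v ->
  exists n, iter n (br x) v <> 0 /\ br x (iter n (br x) v) = 0.
Proof.
move=> v0 [n]; elim: n => [//|n IH] /= nv.
by case: (classic (iter n (br x) v = 0)) => [/IH|]; last by exists n.
Qed.

(** * Weight vectors under a locally nilpotent sl_2-triple *)

Section Sl2.
Variables e f h : L.
Hypothesis tr : sl2_triple e f h.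

Lemma sl2_weight_f c v k : br h v = c *: v ->
  br h (iter k (br f) v) = (c - 2 * k%:R) *: iter k (br f) v.
Proof.
case: tr => he hf ef hv; elim: k => [|k IH] /=; first by rewrite mulr0 subr0.
rewrite brJ hf IH brNl brZl brZr -scaleNr -scalerDl; congr (_ *: _).
by rewrite -natr1; ring.
Qed.

Lemma sl2_weight_e c v k : br h v = c *: v ->
  br h (iter k (br e) v) = (c + 2 * k%:R) *: iter k (br e) v.
Proof.
case: tr => he hf ef hv; elim: k => [|k IH] /=; first by rewrite mulr0 addr0.
rewrite brJ he IH brZl brZr -scalerDl; congr (_ *: _).
by rewrite -natr1; ring.
Qed.

Lemma sl2_ef c v k : br h v = c *: v ->
  br e (iter k.+1 (br f) v) =
    iter k.+1 (br f) (br e v) + (k.+1%:R * (c - k%:R)) *: iter k (br f) v.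
Proof.
case: (tr) => he hf ef hv; elim: k => [|k IH].
  by rewrite /= brJ ef hv addrC subr0 mul1r.
rewrite iterS brJ ef IH brDr brZr -!iterS (sl2_weight_f k.+1 hv).
rewrite [LHS]addrCA -scalerDl; congr (_ + _ *: _).
by rewrite -!natr1; ring.
Qed.

Hypothesis char0 : [pchar F] =i pred0.
Hypotheses (nilp_e : forall v, nilp_at e v) (nilp_f : forall v, nilp_at f v).

(** At the last nonzero f^n v, [sl2_ef] reads 0 = (n+1)(c - n) f^n v. *)
Lemma sl2_highest_weight c v : v <> 0 -> br h v = c *: v -> br e v = 0 ->
  exists n, c = n%:R.
Proof.
move=> v0 hv ev; have [n [nv fnv]] := nilp_at_last v0 (nilp_f v).
exists n; have := sl2_ef n hv; rewrite [iter n.+1 _ v]iterS fnv ev iter_br0 br0r add0r.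
move=> /esym/eqP; rewrite scaler_eq0 mulf_eq0 natF_eq0 //= subr_eq0.
by case/orP => [/eqP //|/eqP /nv].
Qed.

Lemma sl2_weight_int c v : v <> 0 -> br h v = c *: v -> exists n : int, c = n%:~R.
Proof.
move=> v0 hv; have [n [nv env]] := nilp_at_last v0 (nilp_e v).
have [m cm] := sl2_highest_weight nv (sl2_weight_e n hv) env.
exists (m%:Z - 2 * n%:Z); rewrite rmorphB rmorphM /= -!pmulrn -cm.
by rewrite addrK.
Qed.

(** Induction on N with e^N v = 0: e v has weight n + 2 and is killed by f^(k+1), so it vanishes.
    Once e v = 0, the coefficients (j+1)(n-j), j < k, of [sl2_ef] are nonzero. *)
Lemma sl2_f_inj c v n k : br h v = c *: v -> c = n%:R -> (k <= n)%N ->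
  iter k (br f) v = 0 -> v = 0.
Proof.
move=> hv; have [N] := nilp_e v; elim: N c v n k hv => [//|N IH] c v n k hv.
rewrite iterSr => eNv cn kn fkv.
have ev0 : br e v = 0.
  have hw : br h (br e v) = (c + 2) *: br e v.
    by have := sl2_weight_e 1 hv; rewrite mulr1.
  have cn2 : c + 2 = n.+2%:R by rewrite cn -[n.+2]addn2 natrD.
  have kn2 : (k.+1 <= n.+2)%N by rewrite ltnS ltnW.
  apply: (IH _ _ _ _ hw eNv cn2 kn2).
  by have := sl2_ef k hv; rewrite iterS fkv !br0r scaler0 addr0 => <-.
elim: k kn fkv => [//|k IHk] kn fkv; apply: IHk; first exact: ltnW.
have := sl2_ef k hv; rewrite fkv ev0 iter_br0 br0r add0r => /esym/eqP.
rewrite scaler_eq0 mulf_eq0 natF_eq0 //= cn -natrB 1?ltnW // natF_eq0 //.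
by rewrite subn_eq0 leqNgt kn /= => /eqP.
Qed.

End Sl2.

(** Covers the string from weight n to its reflection -n; the case of e is that of f for the swapped
    triple (f, e, -h). *)
Lemma sl2_string e f h c v : [pchar F] =i pred0 -> sl2_triple e f h ->
  (forall u, nilp_at e u) -> (forall u, nilp_at f u) ->
  v <> 0 -> br h v = c *: v -> exists n : int,
    [/\ c = n%:~R,
        forall k : nat, k%:Z <= n -> iter k (br f) v <> 0 &
        forall k : nat, k%:Z <= - n -> iter k (br e) v <> 0].
Proof.
move=> char0 tr ne nf v0 hv; have [n cn] := sl2_weight_int tr char0 ne nf v0 hv.
exists n; split=> // k.
- case: n cn => // n cn kn fk0; apply: v0.
  exact: (sl2_f_inj tr char0 ne hv cn kn fk0).
- move=> kn ek0; apply: v0.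
  have hv' : br (- h) v = (- c) *: v by rewrite brNl hv scaleNr.
  apply: (sl2_f_inj (sl2_tripleC tr) char0 nf hv' (n := `|n|%N) _ _ ek0).
    by rewrite cn -rmorphN /= pmulrn; congr (_%:~R); lia.
  by lia.
Qed.

End Lie.

(** * Weights, root strings and Cartan integers *)

Section Subspace.
Variables (F : fieldType) (L : lmodType F).
Variables (S : L -> Prop).
Hypothesis subS : subspace S.

Lemma subspace0 : S 0. Proof. by case: subS. Qed.

Lemma subspaceZ a x : S x -> S (a *: x).
Proof. by case: subS => S0 SD Sx; rewrite -[a *: x]addr0; apply: SD. Qed.

Lemma subspaceD x y : S x -> S y -> S (x + y).
Proof. by case: subS => S0 SD Sx Sy; rewrite -[x]scale1r; apply: SD. Qed.

Lemma subspaceN x : S x -> S (- x).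
Proof. by rewrite -scaleN1r; apply: subspaceZ. Qed.

Lemma subspaceB x y : S x -> S y -> S (x - y).
Proof. by move=> Sx Sy; apply: subspaceD => //; apply: subspaceN. Qed.

Lemma subspace_sum (I : eqType) (s : seq I) (E : I -> L) :
  (forall i, i \in s -> S (E i)) -> S (\sum_(i <- s) E i).
Proof.
move=> SE; rewrite big_seq_cond.
by apply: (big_ind S); [exact: subspace0 | exact: subspaceD | move=> i /andP[/SE]].
Qed.

End Subspace.

Section WeightVectors.
Variables (F : fieldType) (L : lmodType F) (br : L -> L -> L).
Hypothesis lieP : lie_bracket br.
Variable K : L -> Prop.

Definition weight_vec (b : L -> F) (x : L) : Prop :=
  forall h, K h -> br h x = b h *: x.

Lemma weight_vecZ b c x : weight_vec b x -> weight_vec b (c *: x).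
Proof. by move=> bx h Kh; rewrite (brZr lieP) bx // scalerA mulrC -scalerA. Qed.

Lemma subspace_weight b : subspace (weight_vec b).
Proof.
split=> [h Kh|a x y bx bY h Kh]; first by rewrite (br0r lieP) scaler0.
rewrite (brDr lieP) (brZr lieP) bx // bY // scalerDr; congr (_ + _).
by rewrite !scalerA mulrC.
Qed.

Variable S : L -> Prop.
Hypotheses (subS : subspace S) (stabS : forall h x, K h -> S x -> S (br h x)).

(* The operators [ad h - w k h] kill the unwanted components one at a time. *)
Lemma weight_proj (T : eqType) (s : seq T) (w : T -> L -> F) (g : T -> L) b y :
  weight_vec b y -> (forall k, k \in s -> weight_vec (w k) (g k)) ->
  (forall k, k \in s -> exists h, K h /\ w k h <> b h) ->
  S (y + \sum_(k <- s) g k) -> S y.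
Proof.
elim: s g y => [|k s IH] g y yb gw sep; first by rewrite big_nil addr0.
rewrite big_cons => Sy.
have [h [Kh /eqP wb]] := sep k (mem_head _ _).
have c0 : b h - w k h != 0 by rewrite subr_eq0 eq_sym.
suff Scy : S ((b h - w k h) *: y).
  by rewrite -[y](scalerK c0); apply: subspaceZ.
apply: (IH (fun j => (w j h - w k h) *: g j)).
- exact: weight_vecZ.
- by move=> j js; apply: weight_vecZ; apply: gw; rewrite inE js orbT.
- by move=> j js; apply: sep; rewrite inE js orbT.
have := subspaceB subS (stabS Kh Sy) (subspaceZ subS (w k h) Sy).
rewrite !(brDr lieP) (br_sumr lieP) yb // gw ?mem_head // !scalerDr scaler_sumr.
suff -> : (b h - w k h) *: y + \sum_(j <- s) (w j h - w k h) *: g j =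
  b h *: y + (w k h *: g k + \sum_(i <- s) br h (g i)) -
    (w k h *: y + (w k h *: g k + \sum_(i <- s) w k h *: g i)) by [].
have -> : \sum_(i <- s) br h (g i) = \sum_(i <- s) w i h *: g i.
  by apply: eq_big_seq => i si; rewrite gw // inE si orbT.
rewrite scalerBl opprD addrACA; congr (_ + _).
rewrite opprD addrACA subrr add0r -sumrB.
by apply: eq_bigr => i _; rewrite scalerBl.
Qed.

Lemma weight_comp (T : eqType) (s : seq T) (w : T -> L -> F) (g : T -> L) k :
  uniq s -> (forall k, k \in s -> weight_vec (w k) (g k)) ->
  (forall j, j \in s -> j != k -> exists h, K h /\ w j h <> w k h) ->
  S (\sum_(k <- s) g k) -> k \in s -> S (g k).
Proof.
move=> us gw sep Sg ks; rewrite (bigD1_seq k) //= in Sg.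
rewrite -big_filter in Sg; apply: (weight_proj (w := w)) Sg; first exact: gw.
- by move=> j; rewrite mem_filter => /andP[_ /gw].
- by move=> j; rewrite mem_filter => /andP[jk js]; apply: sep.
Qed.

End WeightVectors.

Lemma mulz_neq_between (m x y : int) : 0 < y < x -> m * x <> y.
Proof.
move=> /andP[y0 yx] E; have x0 := lt_trans y0 yx.
have m0 : 0 < m by rewrite -(pmulr_lgt0 _ x0) E.
by have : x <= y; [rewrite -E; apply: ler_peMl; [exact: ltW|] | rewrite leNgt yx].
Qed.

(* Here n = <b, a^vee>, q = <a, b^vee> and m = <a, (b + 3a)^vee>; the equation is the
   formula for m with denominators cleared. *)
Lemma cartan_string_bound (m n q : int) : n <= - 7 -> q != 0 ->
  m * (n + 3 * q * (n + 3)) = q * (n + 6) -> False.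
Proof.
move=> n7 q0; have [a -> a0] : exists2 a : int, n = - (a + 7) & 0 <= a.
  by exists (- n - 7); lia.
have -> : - (a + 7) + 3 * q * (- (a + 7) + 3) = - (a + 7 + 3 * q * (a + 4)) by ring.
have -> : q * (- (a + 7) + 6) = - (q * (a + 1)) by ring.
rewrite mulrN => /oppr_inj.
(* For either sign of q, once signs are cleared, the right-hand side lies strictly between 0 and the
   cofactor of m, so it is no multiple of it. *)
have [q_lt|q_gt] : q < 0 \/ 0 < q by lia.
- have [b -> b0] : exists2 b : int, q = - (b + 1) & 0 <= b by exists (- q - 1); lia.
  have ab : 0 <= b * a by apply: mulr_ge0.
  have -> : a + 7 + 3 * - (b + 1) * (a + 4) = - (3 * (b * a) + 12 * b + 2 * a + 5) by ring.
  have -> : - (b + 1) * (a + 1) = - (b * a + b + a + 1) by ring.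
  rewrite mulrN => /oppr_inj; apply: mulz_neq_between; lia.
- have [b -> b0] : exists2 b : int, q = b + 1 & 0 <= b by exists (q - 1); lia.
  have ab : 0 <= b * a by apply: mulr_ge0.
  have -> : a + 7 + 3 * (b + 1) * (a + 4) = 3 * (b * a) + 12 * b + 4 * a + 19 by ring.
  have -> : (b + 1) * (a + 1) = b * a + b + a + 1 by ring.
  apply: mulz_neq_between; lia.
Qed.

Section InvariantForm.
Variables (F : fieldType) (L : lmodType F) (br : L -> L -> L) (form : L -> L -> F).
Hypothesis formP : invariant_form br form.

Lemma formDl x y z : form (x + y) z = form x z + form y z.
Proof. by case: formP => E _; have := E 1 x y z; rewrite scale1r mul1r. Qed.

Lemma formC x y : form x y = form y x.
Proof. by case: formP => _ []. Qed.

Lemma form0l z : form 0 z = 0.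
Proof. by apply: (addIr (form 0 z)); rewrite -formDl !add0r. Qed.

Lemma formZl a x z : form (a *: x) z = a * form x z.
Proof.
by case: formP => E _; have := E a x 0 z; rewrite !addr0 form0l addr0.
Qed.

Lemma formNl x z : form (- x) z = - form x z.
Proof. by rewrite -scaleN1r formZl mulN1r. Qed.

Lemma formBl x y z : form (x - y) z = form x z - form y z.
Proof. by rewrite formDl formNl. Qed.

Lemma formDr x y z : form z (x + y) = form z x + form z y.
Proof. by rewrite !(formC z) formDl. Qed.

Lemma formZr a x z : form z (a *: x) = a * form z x.
Proof. by rewrite !(formC z) formZl. Qed.

Lemma formNr x z : form z (- x) = - form z x.
Proof. by rewrite !(formC z) formNl. Qed.

Lemma formBr x y z : form z (x - y) = form z x - form z y.
Proof. by rewrite formDr formNr. Qed.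

Lemma form_suml (I : Type) (s : seq I) (P : pred I) (E : I -> L) x :
  form (\sum_(i <- s | P i) E i) x = \sum_(i <- s | P i) form (E i) x.
Proof. by apply: (big_morph (form^~ x)) => [y z|]; rewrite ?formDl ?form0l. Qed.

Lemma formMnl x y k : form (x *+ k) y = form x y *+ k.
Proof. by elim: k => [|k IH]; rewrite ?mulr0n ?form0l // !mulrS formDl IH. Qed.

Lemma formMnr x y k : form y (x *+ k) = form y x *+ k.
Proof. by rewrite !(formC y) formMnl. Qed.

End InvariantForm.

(** * Isotropic roots and bounds on Cartan integers *)

Section RootData.
Variables (F : fieldType) (L : lmodType F) (br : L -> L -> L) (form : L -> L -> F).
Variable H : L -> Prop.

(* The weight [h |-> (t, h)] of H is represented by the vector t = t_alpha of H. *)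
Definition wt (t x : L) : Prop := weight_vec br H (form t) x.

Definition rt (t : L) : Prop := H t /\ exists x, x <> 0 /\ wt t x.

Record root_data : Prop := RootData {
  rd_char : [pchar F] =i pred0;
  rd_lie :> lie_bracket br;
  rd_form :> invariant_form br form;
  rd_sub : subspace H;
  rd_iso : forall d, rt d -> form d d = 0 ->
    exists x y, [/\ wt d x, wt (- d) y & br x y = d];
  rd_noniso : forall a x, rt a -> form a a <> 0 -> wt a x -> x <> 0 ->
    exists y, wt (- a) y /\ br x y = a;
  rd_nilp : forall a x, rt a -> form a a <> 0 -> wt a x -> forall y, nilp_at br x y;
  rd_iso_nonisol : forall d, rt d -> form d d = 0 ->
    exists a, [/\ rt a, form a a <> 0 & rt (a + d)] }.

Hypothesis RD : root_data.
Let lieP := rd_lie RD.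
Let char0 := rd_char RD.
Let subH := rd_sub RD.
Let formDl := formDl RD.
Let formC := formC RD.
Let form0l := form0l RD.
Let formZl := formZl RD.
Let formNl := formNl RD.
Let formBl := formBl RD.
Let formDr := formDr RD.
Let formZr := formZr RD.
Let formNr := formNr RD.
Let formBr := formBr RD.
Let form_suml := form_suml RD.
Let formMnl := formMnl RD.
Let formMnr := formMnr RD.

Lemma wt_br s t x y : wt s x -> wt t y -> wt (s + t) (br x y).
Proof.
move=> sx ty h Hh; rewrite (brJ lieP) (sx h Hh) (ty h Hh) (brZl lieP) (brZr lieP).
by rewrite -scalerDl formDl.
Qed.

Lemma wt_iter s t x y k : wt s x -> wt t y -> wt (t + s *+ k) (iter k (br x) y).
Proof.
move=> sx ty; elim: k => [|k IH]; first by rewrite mulr0n addr0.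
by rewrite iterS mulrS addrCA; apply: wt_br.
Qed.

Lemma subspace_Mn t k : H t -> H (t *+ k).
Proof. by move=> Ht; rewrite -scaler_nat; apply: subspaceZ. Qed.

Lemma rt_mem t : rt t -> H t. Proof. by case. Qed.

Lemma rt_opp a : rt a -> rt (- a).
Proof.
case: (classic (a = 0)) => [->|a0 ra]; first by rewrite oppr0.
split; first by apply: subspaceN => //; case: ra.
have [iso|niso] := classic (form a a = 0).
  have [x [y [_ ya xy]]] := rd_iso RD ra iso.
  by exists y; split=> // y0; apply: a0; rewrite -xy y0 (br0r lieP).
have [Ha [x [x0 xa]]] := ra.
have [y [ya xy]] := rd_noniso RD ra niso xa x0.
by exists y; split=> // y0; apply: a0; rewrite -xy y0 (br0r lieP).
Qed.

Definition coroot a : L := (2 / form a a) *: a.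

Lemma form_coroot a b : form b (coroot a) = 2 * form b a / form a a.
Proof. by rewrite formZr mulrAC. Qed.

Lemma coroot_mem a : H a -> H (coroot a).
Proof. exact: subspaceZ. Qed.

Lemma root_sl2 a x : rt a -> form a a <> 0 -> wt a x -> x <> 0 ->
  exists y, [/\ wt (- a) y, sl2_triple br x y (coroot a),
                forall u, nilp_at br x u & forall u, nilp_at br y u].
Proof.
move=> ra na xa x0; have [y [ya xy]] := rd_noniso RD ra na xa x0.
move/eqP: (na) => na0.
have y'a : wt (- a) ((2 / form a a) *: y) by apply: weight_vecZ.
exists ((2 / form a a) *: y); split=> //; last 2 first.
- exact: rd_nilp ra na xa.
- apply: rd_nilp y'a => //; first exact: rt_opp.
  by rewrite formNl formNr opprK.
have Hc : H (coroot a) by apply: coroot_mem; case: ra.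
split; first by rewrite xa // form_coroot mulfK.
- by rewrite y'a // formNl form_coroot mulfK // scaleNr.
- by rewrite (brZr lieP) xy.
Qed.

(** The triple of [root_sl2] acts on a root vector of b; n is <b, a^vee>, and the roots obtained run
    from b to its reflection b - n a. *)
Lemma root_string a b : rt a -> form a a <> 0 -> rt b -> exists n : int,
  [/\ n%:~R * form a a = 2 * form b a,
      forall k : nat, k%:Z <= n -> rt (b - a *+ k) &
      forall k : nat, k%:Z <= - n -> rt (b + a *+ k)].
Proof.
move=> ra na rb; have [Ha [x [x0 xa]]] := ra; have [Hb [v [v0 vb]]] := rb.
have [y [ya tr nx ny]] := root_sl2 ra na xa x0.
have [n [cn fs es]] := sl2_string lieP char0 tr nx ny v0 (vb _ (coroot_mem Ha)).
exists n; split.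
- by rewrite -cn form_coroot mulfVK //; apply/eqP.
- move=> k /fs kn; split; first by apply: subspaceB => //; apply: subspace_Mn.
  by exists (iter k (br y) v); split=> //; rewrite -mulNrn; apply: wt_iter.
- move=> k /es kn; split; first by apply: subspaceD => //; apply: subspace_Mn.
  by exists (iter k (br x) v); split=> //; apply: wt_iter.
Qed.

(* [x], [y], [d] act on [a + Z d] as a Heisenberg algebra with central charge
   (a, d) <> 0, so the string cannot terminate in both directions. *)
Lemma heisenberg_string a d k : rt a -> rt d -> form d d = 0 -> form a d <> 0 ->
  rt (a + d *+ k) \/ rt (a - d *+ k).
Proof.
move=> ra rd id nad; have [x [y [xd yd xy]]] := rd_iso RD rd id.
have [Ha [v [v0 va]]] := ra; have [Hd _] := rd.
case: (classic (iter k (br x) v = 0)) => [xk0|xk]; last first.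
  left; split; first by apply: subspaceD => //; apply: subspace_Mn.
  by exists (iter k (br x) v); split=> //; apply: wt_iter.
have [N [wN xw]] := nilp_at_last v0 (ex_intro _ k xk0).
right; split; first by apply: subspaceB => //; apply: subspace_Mn.
set w := iter N (br x) v in wN xw.
have ww : wt (a + d *+ N) w by apply: wt_iter.
have yw j : wt (a + d *+ N - d *+ j) (iter j (br y) w).
  by rewrite -mulNrn; apply: wt_iter.
(* Each commutator [x, y] = d acts on every y^j w by (a, d), as (d, d) = 0. The factors (j+1)(a, d)
   are nonzero, so y never kills w. *)
have xyw j : br x (iter j.+1 (br y) w) = (j.+1%:R * form a d) *: iter j (br y) w.
  elim: j => [|j IH].
    by rewrite /= (brJ lieP) xy xw (br0r lieP) addr0 ww // formDl formMnl id mul0rn addr0 mul1r.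
  rewrite iterS (brJ lieP) xy IH (brZr lieP) -iterS yw //.
  rewrite -scalerDl formBl formDl !formMnl id !mul0rn subr0 addr0.
  by congr (_ *: _); rewrite -[in RHS]natr1 mulrDl mul1r addrC.
have nz j : iter j (br y) w <> 0.
  elim: j => [//|j IH] E; apply: IH; have /esym/eqP := xyw j.
  rewrite E (br0r lieP) scaler_eq0 mulf_eq0 natF_eq0 //= => /orP[/eqP //|/eqP //].
(* N extra steps undo the N d gained in passing from v to w. *)
exists (iter (N + k) (br y) w); split=> //.
by have := yw (N + k)%N; rewrite mulrnDr opprD addrA addrK.
Qed.

(** Let r = <d, a^vee> be nonzero. Up to the sign of d, b = a + 3d is a root with (b, b) = (1 +
    3r)(a, a), and <a, b^vee> = 1 + 1/(1 + 3r) is not an integer. The multiple 3 matters: 1 + 2r =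
    -1 has the solution r = -1. *)
Lemma iso_orth_noniso a d : rt a -> form a a <> 0 -> rt d -> form d d = 0 ->
  form a d = 0.
Proof.
move=> ra na rd id; apply: NNPP => nad.
have main : forall d', rt d' -> form d' d' = 0 -> form a d' <> 0 ->
    rt (a + d' *+ 3) -> False.
  move=> {d rd id nad}d rd id nad rb; have [r [Er _ _]] := root_string ra na rd.
  have na0 : form a a != 0 by apply/eqP.
  set b := a + d *+ 3 in rb.
  have r0 : r != 0.
    apply/eqP => r0; move: Er; rewrite r0 mul0r => /esym/eqP.
    by rewrite mulf_eq0 natF_eq0 //= formC => /eqP.
  have Eba : form b a = form a a + 3 * form d a.
    by rewrite formDl formMnl mulr_natl.
  have Ebb : form b b = form a a * (1 + 3 * r)%:~R.
    rewrite formDr formMnr Eba formDl formMnl id mul0rn addr0 (formC a d).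
    by rewrite rmorphD rmorphM /= mulrDr mulr1 mulrCA (mulrC (form a a)) Er; ring.
  have nb : form b b <> 0.
    apply/eqP; rewrite Ebb mulf_neq0 // intF_eq0 //; lia.
  have [m [Em _ _]] := root_string rb nb ra.
  have : (m * (1 + 3 * r))%:~R * form a a = (2 + 3 * r)%:~R * form a a.
    move: Em; rewrite Ebb (formC a b) Eba => Em.
    rewrite rmorphM /= -mulrA (mulrC _ (form a a)) Em.
    rewrite rmorphD rmorphM /=.
    have -> : 2 * (form a a + 3 * form d a) = 2 * form a a + 3 * (2 * form d a) by ring.
    by rewrite -Er; ring.
  move/(mulIf na0)/(intF_inj char0) => Emr.
  have E1 : (m - 1) * (1 + 3 * r) = 1 by rewrite mulrBl Emr; ring.
  have [m1|m1|m1] := ltgtP m 1; first nia.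
    nia.
  by move: E1; rewrite m1 subrr mul0r.
have [rb|rb] := heisenberg_string 3 ra rd id nad; first exact: main rb.
apply: (main (- d)); rewrite ?formNl ?formNr ?opprK ?mulNrn //; first exact: rt_opp.
by move/eqP; rewrite oppr_eq0 => /eqP.
Qed.

(** For isotropic b, take a nonisotropic root a with a + b a root. As (a, b) = 0, a + b is
    nonisotropic too; d is orthogonal to a and a + b, hence to b. *)
Lemma iso_orth d b : rt d -> form d d = 0 -> rt b -> form d b = 0.
Proof.
move=> rd id rb; case: (classic (form b b = 0)) => [ib|nb]; last first.
  by rewrite formC iso_orth_noniso.
have [a [ra na rab]] := rd_iso_nonisol RD rb ib.
have ab : form a b = 0 by apply: iso_orth_noniso.
have nab : form (a + b) (a + b) <> 0.
  by rewrite formDl !formDr (formC b a) ab ib !addr0.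
have := iso_orth_noniso rab nab rd id.
by rewrite formDl iso_orth_noniso // add0r formC.
Qed.

(** If n <= -7, the a-string through b contains the root c = b + 3a, and <b, a^vee>, <a, b^vee>, <a,
    c^vee> satisfy the equation excluded by [cartan_string_bound]. *)
Lemma cartan_lower_bound a b (n : int) : rt a -> form a a <> 0 -> rt b ->
  n%:~R * form a a = 2 * form b a -> - 7 < n.
Proof.
move=> ra na rb En; rewrite ltNge; apply/negP => n7.
have na0 : form a a != 0 by apply/eqP.
have [n' [En' _ str]] := root_string ra na rb.
have nn : n' = n by apply: (intF_inj char0); apply: (mulIf na0); rewrite En' En.
have rc : rt (b + a *+ 3) by apply: str; rewrite nn; lia.
set c := b + a *+ 3 in rc.
have Eca : 2 * form c a = (n + 6)%:~R * form a a.
  by rewrite formDl formMnl rmorphD /= [RHS]mulrDl En; ring.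
have n6 : (n + 6)%:~R != 0 :> F by rewrite intF_eq0 //; lia.
have n0 : n != 0 by lia.
(* An isotropic c would be orthogonal to a, but <c, a^vee> = n + 6 is nonzero; likewise for b and
   n. *)
have [ic|nc] := classic (form c c = 0).
  move: Eca; rewrite (iso_orth rc ic ra) mulr0 => /esym/eqP.
  by rewrite mulf_eq0 (negPf n6) (negPf na0).
have nb : form b b <> 0.
  move=> ib; move: En; rewrite (iso_orth rb ib ra) mulr0 => /eqP.
  by rewrite mulf_eq0 intF_eq0 // (negPf n0) (negPf na0).
have [q [Eq _ _]] := root_string rb nb ra.
have Eqn : q%:~R * form b b = n%:~R * form a a by rewrite Eq En formC.
have q0 : q != 0.
  apply/eqP => q0; move/esym/eqP: Eqn.
  by rewrite q0 mul0r mulf_eq0 intF_eq0 // (negPf n0) (negPf na0).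
have [m [Em _ _]] := root_string rc nc ra.
apply: (@cartan_string_bound m n q) => //.
apply: (intF_inj char0); apply: (mulIf na0); rewrite [(m * _)%:~R]rmorphM /= -[LHS]mulrA.
have Ecc : form c c = form b b + (3 * (n + 3))%:~R * form a a.
  rewrite /c formDr formMnr !(formDl b) !formMnl (formC a b).
  have -> : (3 * (n + 3))%:~R * form a a = 3 * (n%:~R * form a a) + 9 * form a a.
    by rewrite rmorphM rmorphD /=; ring.
  by rewrite En; ring.
have -> : (n + 3 * q * (n + 3))%:~R * form a a = q%:~R * form c c.
  by rewrite Ecc [RHS]mulrDr Eqn !rmorphM !rmorphD !rmorphM /=; ring.
have -> : (q * (n + 6))%:~R * form a a = q%:~R * (m%:~R * form c c).
  by rewrite Em (formC a) Eca rmorphM /= mulrA.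
by rewrite mulrCA.
Qed.

End RootData.

(** * The finite root system in the lattice of the base *)

Section Base.
Variables (F : fieldType) (L : lmodType F) (br : L -> L -> L) (form : L -> L -> F).
Variable H : L -> Prop.
Variables (l : nat) (t : 'I_l -> L).
Implicit Types (k x y : 'rV[int]_l) (r v : L).
Local Notation rt := (rt br form H).

Definition orth v : Prop := forall r, rt r -> form v r = 0.

Definition vec k : L := \sum_i (k 0 i)%:~R *: t i.

Definition nonneg k : Prop := forall i, 0 <= k 0 i.

Record base_data : Prop := BaseData {
  bd_rt : forall i, rt (t i);
  bd_indep : forall k, orth (vec k) -> k = 0;
  bd_coord : forall r, rt r ->
    exists k, (nonneg k \/ nonneg (- k)) /\ orth (r - vec k) }.

Hypotheses (RD : root_data br form H) (BD : base_data).
Let char0 := rd_char RD.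
Let subH := rd_sub RD.
Let formDl := formDl RD.
Let formDr := formDr RD.
Let formBl := formBl RD.
Let formBr := formBr RD.
Let formZl := formZl RD.
Let formZr := formZr RD.
Let formC := formC RD.

Lemma vecZD (c : int) x y : vec (c *: x + y) = c%:~R *: vec x + vec y.
Proof.
rewrite /vec scaler_sumr -big_split /=; apply: eq_bigr => i _.
by rewrite !mxE rmorphD rmorphM /= scalerDl scalerA.
Qed.

Lemma vec0 : vec 0 = 0.
Proof. by rewrite /vec big1 // => i _; rewrite mxE scale0r. Qed.

Lemma vecD x y : vec (x + y) = vec x + vec y.
Proof. by have := vecZD 1 x y; rewrite !scale1r. Qed.

Lemma vecZ (c : int) x : vec (c *: x) = c%:~R *: vec x.
Proof. by have := vecZD c x 0; rewrite vec0 !addr0. Qed.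

Lemma vecN x : vec (- x) = - vec x.
Proof. by rewrite -[- x]scaleN1r vecZ scaleN1r. Qed.

Lemma vecB x y : vec (x - y) = vec x - vec y.
Proof. by rewrite vecD vecN. Qed.

Lemma vec_delta i : vec (delta_mx 0 i) = t i.
Proof.
rewrite /vec (bigD1 i) //= mxE !eqxx scale1r big1 ?addr0 // => j ji.
by rewrite mxE eqxx (negPf ji) scale0r.
Qed.

Lemma vec_mem k : H (vec k).
Proof.
apply: (subspace_sum subH) => i _; apply: (subspaceZ subH).
by apply: rt_mem; apply: bd_rt.
Qed.

Lemma subspace_orth : subspace orth.
Proof.
split=> [r _|a u v ou ov r rr]; first exact: form0l RD r.
by rewrite formDl formZl ou // ov // mulr0 addr0.
Qed.

Lemma orth_vec v k : orth v -> form v (vec k) = 0.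
Proof.
move=> ov; rewrite formC (form_suml RD) big1 // => i _.
by rewrite formZl formC ov ?mulr0 //; apply: bd_rt.
Qed.

(** Modulo the radical every root is a combination of the base, so orthogonality to the base is
    orthogonality to all roots. *)
Lemma orth_vecP k : (forall i, form (vec k) (t i) = 0) -> k = 0.
Proof.
move=> Hk; apply: (bd_indep BD) => r rr; have [j [_ oj]] := bd_coord BD rr.
rewrite -[r](subrK (vec j)) formDr (formC _ (r - _)) orth_vec // add0r.
rewrite formC (form_suml RD) big1 // => i _.
by rewrite formZl formC Hk mulr0.
Qed.

Lemma vec_inj : injective vec.
Proof.
move=> x y xy; apply/eqP; rewrite -subr_eq0; apply/eqP; apply: (bd_indep BD).
by rewrite vecB xy subrr; case: subspace_orth.
Qed.

Lemma coord_uniq r x y : orth (r - vec x) -> orth (r - vec y) -> x = y.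
Proof.
move=> ox oy; apply/eqP; rewrite -subr_eq0; apply/eqP; apply: (bd_indep BD).
have -> : vec (x - y) = r - vec y - (r - vec x).
  by rewrite vecB opprB [RHS]addrC addrA subrK.
exact: (subspaceB subspace_orth).
Qed.

Lemma form_coord r r' x y : rt r' -> orth (r - vec x) -> orth (r' - vec y) ->
  form r r' = form (vec x) (vec y).
Proof.
move=> rr' ox oy; rewrite -[r in LHS](subrK (vec x)) formDl ox // add0r.
by rewrite -[r'](subrK (vec y)) formDr (formC _ (r' - _)) orth_vec // add0r.
Qed.

(** [vec k] itself need not be a root; its class modulo the radical has to contain a nonisotropic
    one. *)
Definition Phi k : Prop :=
  exists r, [/\ rt r, form r r <> 0 & orth (r - vec k)].

Lemma Phi_form_neq0 k : Phi k -> form (vec k) (vec k) != 0.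
Proof. by case=> r [rr nr ok]; rewrite -(form_coord rr ok ok); apply/eqP. Qed.

Lemma Phi_neq0 k : Phi k -> k != 0.
Proof.
move=> Pk; apply: contraNneq (Phi_form_neq0 Pk) => ->.
by rewrite vec0 (form0l RD).
Qed.

Lemma rt_Phi r k : rt r -> orth (r - vec k) -> k != 0 -> Phi k.
Proof.
move=> rr ok k0; exists r; split=> // ir; move/eqP: k0; apply.
apply: (coord_uniq ok); rewrite vec0 subr0 => b rb; exact: iso_orth ir rb.
Qed.

Lemma rt_vec_Phi k : rt (vec k) -> k != 0 -> Phi k.
Proof.
move=> rk; apply: (rt_Phi rk); rewrite subrr; by case: subspace_orth.
Qed.

Lemma delta_neq0 (i : 'I_l) : (delta_mx 0 i : 'rV[int]_l) != 0.
Proof. by apply/eqP => /rowP /(_ i); rewrite !mxE !eqxx. Qed.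

Lemma Phi_delta i : Phi (delta_mx 0 i).
Proof.
by apply: rt_vec_Phi (delta_neq0 i); rewrite vec_delta; apply: bd_rt.
Qed.

Lemma t_form_neq0 i : form (t i) (t i) != 0.
Proof. by have := Phi_form_neq0 (Phi_delta i); rewrite vec_delta. Qed.

Lemma Phi_sign k : Phi k -> nonneg k \/ nonneg (- k).
Proof.
case=> r [rr _ ok]; have [j [sj oj]] := bd_coord BD rr.
by rewrite (coord_uniq ok oj).
Qed.

Lemma PhiN k : Phi k -> Phi (- k).
Proof.
case=> r [rr nr ok]; exists (- r); split; first exact: rt_opp rr.
  by rewrite (formNl RD) (formNr RD) opprK.
by rewrite vecN -opprD; apply: (subspaceN subspace_orth).
Qed.

(** * Cartan integers and reflections on the lattice *)

Definition is_pairing k x (n : int) : Prop :=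
  n%:~R * form (vec k) (vec k) = 2 * form (vec x) (vec k).

(* The Cartan integer [<x, k^vee>]; junk unless [Phi k]. *)
Definition pairing k x : int := epsilon (inhabits 0) (is_pairing k x).

Lemma pairing_uniq k x (n : int) : Phi k ->
  n%:~R * form (vec k) (vec k) = 2 * form (vec x) (vec k) -> pairing k x = n.
Proof.
move=> Pk En; apply: (intF_inj char0); apply: (mulIf (Phi_form_neq0 Pk)).
rewrite En; apply: (epsilon_spec (inhabits (0 : int)) (is_pairing k x)).
by exists n.
Qed.

(** A root r above k has integral <t i, r^vee> by [root_string]; the same combination of these
    integers as in x is the witness. *)
Lemma pairingE k x : Phi k ->
  (pairing k x)%:~R * form (vec k) (vec k) = 2 * form (vec x) (vec k).
Proof.
move=> Pk; have [r [rr nr ok]] := Pk.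
apply: (epsilon_spec (inhabits (0 : int)) (is_pairing k x)).
have ex i : exists n : int,
    n%:~R * form (vec k) (vec k) = 2 * form (t i) (vec k).
  have [n [En _ _]] := root_string RD rr nr (bd_rt BD i); exists n.
  have oi : orth (t i - vec (delta_mx 0 i)).
    by rewrite vec_delta subrr; case: subspace_orth.
  rewrite -(form_coord rr ok ok) En; congr (_ * _).
  by rewrite (form_coord rr oi ok) vec_delta.
have [n En] := fin_all_exists ex.
exists (\sum_i x 0 i * n i); rewrite /is_pairing rmorph_sum /= mulr_suml.
rewrite [form (vec x) _](form_suml RD) mulr_sumr.
apply: eq_bigr => i _; by rewrite rmorphM /= -mulrA En formZl mulrCA.
Qed.

Lemma pairingZD k (c : int) x y : Phi k ->
  pairing k (c *: x + y) = c * pairing k x + pairing k y.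
Proof.
move=> Pk; apply: pairing_uniq => //; rewrite rmorphD rmorphM /= mulrDl -mulrA.
by rewrite !pairingE // vecZD formDl formZl mulrDr mulrCA.
Qed.

Lemma pairing0 k : Phi k -> pairing k 0 = 0.
Proof.
by move=> Pk; apply: pairing_uniq => //; rewrite vec0 (form0l RD) mul0r mulr0.
Qed.

Lemma pairingD k x y : Phi k -> pairing k (x + y) = pairing k x + pairing k y.
Proof. by move=> Pk; have := pairingZD 1 x y Pk; rewrite scale1r mul1r. Qed.

Lemma pairingZ k (c : int) x : Phi k -> pairing k (c *: x) = c * pairing k x.
Proof. by move=> Pk; have := pairingZD c x 0 Pk; rewrite pairing0 // !addr0. Qed.

Lemma pairingN k x : Phi k -> pairing k (- x) = - pairing k x.
Proof. by move=> Pk; rewrite -scaleN1r pairingZ // mulN1r. Qed.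

Lemma pairing_self k : Phi k -> pairing k k = 2.
Proof. by move=> Pk; apply: pairing_uniq. Qed.

Definition refl k x : 'rV[int]_l := x - pairing k x *: k.

Lemma reflZD k (c : int) x y : Phi k -> refl k (c *: x + y) = c *: refl k x + refl k y.
Proof.
move=> Pk; rewrite /refl pairingZD // scalerDl scalerBr scalerA opprD.
by rewrite addrACA.
Qed.

Lemma reflN k x : Phi k -> refl k (- x) = - refl k x.
Proof. by move=> Pk; rewrite /refl pairingN // opprB scaleNr opprK addrC. Qed.

Lemma reflD k x y : Phi k -> refl k (x + y) = refl k x + refl k y.
Proof. by move=> Pk; have := reflZD 1 x y Pk; rewrite !scale1r. Qed.

Lemma refl_self k : Phi k -> refl k k = - k.
Proof.
by move=> Pk; rewrite /refl pairing_self // scaler_nat mulr2n opprD addrA subrr add0r.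
Qed.

Lemma pairing_refl_same k x : Phi k -> pairing k (refl k x) = - pairing k x.
Proof.
by move=> Pk; rewrite /refl pairingD // pairingN // pairingZ // pairing_self //; ring.
Qed.

Lemma reflK k : Phi k -> involutive (refl k).
Proof.
move=> Pk x; rewrite {1}/refl pairing_refl_same // scaleNr opprK.
by rewrite /refl subrK.
Qed.

Lemma form_refl k x y : Phi k ->
  form (vec (refl k x)) (vec (refl k y)) = form (vec x) (vec y).
Proof.
move=> Pk; have k0 := Phi_form_neq0 Pk.
rewrite /refl !vecB !vecZ !formBl !formBr !formZl !formZr.
apply: (mulfI (twoF_neq0 char0)).
have Ex := pairingE x Pk; have Ey := pairingE y Pk.
rewrite (formC (vec k) (vec y)).
set a := (pairing k x)%:~R in Ex *; set b := (pairing k y)%:~R in Ey *.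
transitivity (2 * form (vec x) (vec y) - b * (2 * form (vec x) (vec k)) -
    a * (2 * form (vec y) (vec k)) + 2 * a * (b * form (vec k) (vec k))); first by ring.
by rewrite -Ex -Ey; ring.
Qed.

(** The end r' - n r of the r-string through r' is a root lying above the reflected element, and it
    is nonisotropic because reflections are isometries. *)
Lemma Phi_refl k j : Phi k -> Phi j -> Phi (refl k j).
Proof.
move=> Pk Pj; have [r [rr nr ok]] := Pk; have [r' [rr' nr' oj]] := Pj.
have [n [En ns ps]] := root_string RD rr nr rr'.
have n_eq : pairing k j = n.
  by apply: pairing_uniq => //; rewrite -(form_coord rr ok ok) En (form_coord rr oj ok).
have rs : rt (r' - n%:~R *: r).
  case: n {En n_eq} ns ps => n ns ps.
    by rewrite -pmulrn scaler_nat; apply: ns.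
  rewrite NegzE rmorphN /= scaleNr opprK -pmulrn scaler_nat; apply: ps.
  by rewrite NegzE opprK.
have os : orth (r' - n%:~R *: r - vec (refl k j)).
  have -> : r' - n%:~R *: r - vec (refl k j) = (r' - vec j) - n%:~R *: (r - vec k).
    rewrite /refl n_eq vecB vecZ scalerBr !opprB addrACA [RHS]addrACA.
    by congr (_ + _); rewrite addrC.
  by apply: (subspaceB subspace_orth) => //; apply: (subspaceZ subspace_orth).
exists (r' - n%:~R *: r); split=> //.
by rewrite (form_coord rs os os) form_refl //; apply/eqP/Phi_form_neq0.
Qed.

Lemma pairing_refl j k x : Phi j -> Phi k ->
  pairing (refl j k) (refl j x) = pairing k x.
Proof.
move=> Pj Pk; apply: pairing_uniq; first exact: Phi_refl.
by rewrite !form_refl // pairingE.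
Qed.

(** * Finiteness of [Phi] and descent by simple reflections *)

Lemma pairing_delta_inj x y :
  (forall i, pairing (delta_mx 0 i) x = pairing (delta_mx 0 i) y) -> x = y.
Proof.
move=> E; apply/eqP; rewrite -subr_eq0; apply/eqP; apply: orth_vecP => i.
apply: (mulfI (twoF_neq0 char0)); rewrite -vec_delta -pairingE; last exact: Phi_delta.
rewrite pairingD ?pairingN ?E ?subrr ?mul0r ?mulr0 //; exact: Phi_delta.
Qed.

Lemma pairing_bound i k : Phi k -> - 7 < pairing (delta_mx 0 i) k < 7.
Proof.
have lb j : Phi j -> - 7 < pairing (delta_mx 0 i) j.
  case=> r [rr nr oj].
  apply: (cartan_lower_bound RD (bd_rt BD i) _ rr); first by apply/eqP/t_form_neq0.
  have oi : orth (t i - vec (delta_mx 0 i)).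
    by rewrite vec_delta subrr; case: subspace_orth.
  have := pairingE j (Phi_delta i); rewrite vec_delta => ->.
  by rewrite (form_coord (bd_rt BD i) oj oi) vec_delta.
move=> Pk; rewrite lb //=; have := lb _ (PhiN Pk).
by rewrite pairingN ?ltrN2 //; apply: Phi_delta.
Qed.

(** An element of [Phi] is determined by its l Cartan integers against the base, each of which takes
    one of the 13 values from -6 to 6. *)
Lemma Phi_finite : exists s : seq 'rV[int]_l, uniq s /\ forall k, k \in s <-> Phi k.
Proof.
pose code (f : {ffun 'I_l -> 'I_13}) k :=
  Phi k /\ forall i, pairing (delta_mx 0 i) k = (f i)%:Z - 6.
(* The value is arbitrary when no element has code f; the filter by [isPhi] keeps the list inside
   [Phi]. *)
pose dec f := epsilon (inhabits 0) (code f).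
pose isPhi k : bool := if excluded_middle_informative (Phi k) then true else false.
exists (undup [seq k <- [seq dec f | f <- enum {ffun 'I_l -> 'I_13}] | isPhi k]).
split=> [|k]; first exact: undup_uniq.
rewrite mem_undup mem_filter /isPhi.
case: excluded_middle_informative => /= Pk; last by split=> // /Pk.
split=> // _.
have bnd i : (absz (pairing (delta_mx 0%R i) k + 6)%R < 13)%N.
  by have /andP[] := pairing_bound i Pk; lia.
pose f : {ffun 'I_l -> 'I_13} := [ffun i => Ordinal (bnd i)].
have cf : code f k.
  split=> // i; rewrite ffunE /=; have /andP[] := pairing_bound i Pk; lia.
apply/mapP; exists f; first by rewrite mem_enum.
have [_ df] : code f (dec f).
  by apply: (epsilon_spec (inhabits (0 : 'rV[int]_l)) (code f)); exists k.
by apply: pairing_delta_inj => i; rewrite df; case: cf.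
Qed.

(** <alpha_i, (m alpha_i)^vee> = 2/m must be an integer. *)
Lemma Phi_multiple i (m : int) : Phi (m *: delta_mx 0 i) ->
  m \in [:: 1; - 1; 2; - 2].
Proof.
move=> Pm; have m0 : m != 0.
  by apply: contraTneq (Phi_neq0 Pm) => ->; rewrite scale0r eqxx.
have := pairingE (delta_mx 0 i) Pm.
rewrite !vecZ vec_delta !formZl !formZr => E.
have E1 : pairing (m *: delta_mx 0 i) (delta_mx 0 i) * m = 2.
  apply: (intF_inj char0); apply: (mulIf (t_form_neq0 i)).
  have mF : m%:~R != 0 :> F by rewrite intF_eq0.
  apply: (mulIf mF); transitivity (2 * (m%:~R * form (t i) (t i))); last by ring.
  by rewrite -E rmorphM /=; ring.
rewrite !inE; set p := pairing _ _ in E1; clearbody p; clear -E1 m0.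
have : (`|m| %| 2)%N by apply/dvdnP; exists `|p|%N; rewrite -abszM E1.
move/dvdn_leq => /(_ isT); lia.
Qed.

Section Bform.
Variable s : seq 'rV[int]_l.
Hypotheses (us : uniq s) (sP : forall k, k \in s <-> Phi k).

(* The canonical positive form of a finite root system; positive definiteness of
   the original form is thus never needed. *)
Definition Bform x y : int := \sum_(k <- s) pairing k x * pairing k y.

Lemma BformC x y : Bform x y = Bform y x.
Proof. by apply: eq_bigr => k _; rewrite mulrC. Qed.

Lemma BformZD (c : int) x y z : Bform z (c *: x + y) = c * Bform z x + Bform z y.
Proof.
rewrite /Bform mulr_sumr -big_split; apply: eq_big_seq => k /sP Pk /=.
by rewrite pairingZD //; ring.
Qed.

Lemma Bform_refl k x y : Phi k -> Bform (refl k x) (refl k y) = Bform x y.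
Proof.
move=> Pk; have pe : perm_eq s [seq refl k j | j <- s].
  apply: uniq_perm => //; first by rewrite map_inj_uniq //; apply: inv_inj; apply: reflK.
  move=> j; apply/idP/mapP => [/sP Pj|[i /sP Pi ->]]; last by apply/sP; apply: Phi_refl.
  by exists (refl k j); [apply/sP; apply: Phi_refl | rewrite reflK].
rewrite /Bform (perm_big _ pe) big_map; apply: eq_big_seq => j /sP Pj.
by rewrite !pairing_refl.
Qed.

(** Invariance under the reflection in k gives B(k, y) = B(-k, y - p k) with p = <y, k^vee>; solve
    for B(k, y). *)
Lemma Bform_root k y : Phi k -> 2 * Bform k y = pairing k y * Bform k k.
Proof.
move=> Pk; have := Bform_refl k y Pk; rewrite refl_self // /refl.
have -> : y - pairing k y *: k = (- pairing k y) *: k + y by rewrite scaleNr addrC.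
rewrite BformZD !(BformC (- k)).
have BN z : Bform z (- k) = - Bform z k.
  by have := BformZD (- 2) k k z; rewrite scaleNr scaler_nat mulr2n opprD subrK => ->; ring.
rewrite !BN (BformC y k) => E.
have -> : 2 * Bform k y = Bform k y + Bform k y by ring.
by rewrite -{1}E; ring.
Qed.

Lemma Bform_gt0 k : Phi k -> 0 < Bform k k.
Proof.
move=> Pk; have ks : k \in s by apply/sP.
rewrite /Bform (bigD1_seq k) //= pairing_self // ltr_wpDr //.
by apply: sumr_ge0 => j _; rewrite -expr2 sqr_ge0.
Qed.

End Bform.

(** B(k, k) > 0 is the sum of the k_i B(k, alpha_i), so some term is positive; by [Bform_root] its
    Cartan integer has the sign of B(k, alpha_i). *)
Lemma Phi_descent k : Phi k -> nonneg k ->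
  exists i, 0 < k 0 i /\ 0 < pairing (delta_mx 0 i) k.
Proof.
move=> Pk k0; have [s [us sP]] := Phi_finite.
apply: NNPP => no; have := Bform_gt0 us sP Pk; rewrite ltNge => /negP; apply.
have BD0 (x : 'rV[int]_l) I (q : seq I) (E : I -> 'rV[int]_l) (c : I -> int) :
    Bform s x (\sum_(i <- q) c i *: E i) = \sum_(i <- q) c i * Bform s x (E i).
  elim: q => [|i q IH]; last by rewrite !big_cons (BformZD sP) IH.
  by rewrite !big_nil /Bform big1_seq // => j /andP[_ /sP Pj]; rewrite pairing0 ?mulr0.
rewrite {2}(row_sum_delta k) BD0; apply: sumr_le0 => i _.
have := k0 i; rewrite le_eqVlt => /orP[/eqP <-|ki]; first by rewrite mul0r.
rewrite pmulr_rle0 // -(pmulr_rle0 _ (ltr0Sn _ 1)) BformC (Bform_root us sP);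
  last exact: Phi_delta.
rewrite pmulr_lle0; last by apply: (Bform_gt0 us sP); apply: Phi_delta.
by rewrite leNgt; apply/negP => pi; apply: no; exists i.
Qed.

(** Induction on height: a positive k that is no multiple of a simple root is reflected by
    [Phi_descent] to a positive element of smaller height. *)
Lemma Phi_ind (X : 'rV[int]_l -> Prop) :
  (forall i (m : int), m \in [:: 1; - 1; 2; - 2] -> Phi (m *: delta_mx 0 i) ->
     X (m *: delta_mx 0 i)) ->
  (forall i k, Phi k -> X k -> X (refl (delta_mx 0 i) k)) ->
  forall k, Phi k -> X k.
Proof.
move=> X1 XS.
(* k and -k are treated together, so that negative elements are reached through their opposites. *)
have pos (N : nat) k : Phi k -> nonneg k -> \sum_i k 0 i <= N%:Z -> X k /\ X (- k).
  elim: N k => [|N IH] k Pk k0 kN.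
    case/eqP: (Phi_neq0 Pk); apply/rowP => i; rewrite mxE.
    apply/eqP; rewrite eq_le k0 andbT; apply: le_trans kN.
    by rewrite (bigD1 i) //= lerDl sumr_ge0.
  have [i [ki pi]] := Phi_descent Pk k0.
  have [[j [ji kj]]|nj] := classic (exists j : 'I_l, j != i /\ k 0 j != 0); last first.
    have [m Ek] : exists m : int, k = m *: delta_mx 0 i.
      exists (k 0 i); apply/rowP => j; rewrite !mxE eqxx /=.
      have [->|ji] := eqVneq j i; first by rewrite mulr1.
      by rewrite mulr0; apply: NNPP => kj; apply: nj; exists j; split=> //; apply/eqP.
    subst k; split; first by apply: X1 => //; apply: Phi_multiple Pk.
    rewrite -scaleNr; have PNk := PhiN Pk; rewrite -scaleNr in PNk.
    by apply: X1 => //; apply: Phi_multiple PNk.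
  have Pd := Phi_delta i; have Pr := Phi_refl Pd Pk.
  have rj : refl (delta_mx 0 i) k 0 j = k 0 j.
    by rewrite /refl !mxE (negPf ji) andbF mulr0 subr0.
  have kj0 : 0 < k 0 j by rewrite lt_def kj k0.
  (* Only coordinate i changes; the positive coordinate j excludes the negative sign. *)
  have r0 : nonneg (refl (delta_mx 0 i) k).
    case: (Phi_sign Pr) => // /(_ j); rewrite mxE rj; lia.
  have aux (a p S : int) : a + S <= N.+1%:Z -> 0 < p -> a - p + S <= N%:Z by lia.
  have [] := IH _ Pr r0.
    rewrite (bigD1 i) //= in kN; rewrite (bigD1 i) //=.
    rewrite (eq_bigr (fun j : 'I_l => k 0 j)) => [|m mi]; last first.
      by rewrite /refl !mxE (negPf mi) andbF mulr0 subr0.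
    rewrite /refl !mxE !eqxx mulr1; apply: aux kN pi.
  move=> /(XS i _ Pr) Xk /(XS i _ (PhiN Pr)).
  by move: Xk; rewrite reflN // reflK.
move=> k Pk; have [k0|k0] := Phi_sign Pk.
  by case: (pos _ k Pk k0 (lez_abs _)).
by case: (pos _ (- k) (PhiN Pk) k0 (lez_abs _)); rewrite opprK.
Qed.

(** Independence over Z passes to F through the Cartan matrix: an integral row in its kernel pairs
    to 0 with every simple root and so is 0, and its nonzero integral determinant stays nonzero in
    characteristic 0. *)
Lemma gram_nondeg (c : 'I_l -> F) :
  (forall j, \sum_i c i * form (t i) (t j) = 0) -> forall i, c i = 0.
Proof.
move=> Ec.
pose A : 'M[int]_l := \matrix_(i, j) pairing (delta_mx 0 j) (delta_mx 0 i).
have AF : map_mx (intr : int -> F) A \in unitmx.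
  rewrite unitmxE det_map_mx unitfE intF_eq0 //; apply/negP => /det0P[x x0 xA].
  case/eqP: x0; apply: pairing_delta_inj => j; rewrite pairing0; last exact: Phi_delta.
  have /rowP /(_ j) := xA; rewrite !mxE => <-; rewrite {1}(row_sum_delta x).
  elim: (index_enum _) => [|i s IH]; first by rewrite !big_nil pairing0 //; apply: Phi_delta.
  by rewrite !big_cons pairingZD ?IH ?mxE //; apply: Phi_delta.
pose r : 'rV[F]_l := \row_i c i.
have r0 : r = 0.
  apply: (can_inj (mulmxK AF)); rewrite mul0mx; apply/rowP => j; rewrite !mxE.
  apply: (mulIf (t_form_neq0 j)); rewrite mul0r mulr_suml.
  transitivity (2 * \sum_i c i * form (t i) (t j)); last by rewrite Ec mulr0.
  rewrite mulr_sumr; apply: eq_bigr => i _; rewrite !mxE -mulrA.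
  have := pairingE (delta_mx 0 i) (Phi_delta j); rewrite !vec_delta => E.
  by rewrite E mulrCA.
by move=> i; have /rowP /(_ i) := r0; rewrite !mxE.
Qed.

End Base.

(** * The subalgebra generated by the Chevalley generators *)

Section Span.
Variables (F : fieldType) (L : lmodType F) (P : L -> Prop).

(** As an intersection of subspaces, membership applied to a subspace is induction over linear
    combinations. *)
Definition span_of (x : L) : Prop :=
  forall K, subspace K -> (forall y, P y -> K y) -> K x.

Lemma subspace_span : subspace span_of.
Proof.
split=> [K [] //|a x y Sx Sy K sK PK].
by case: (sK) => _; apply; [apply: Sx | apply: Sy].
Qed.

Lemma span_gen x : P x -> span_of x.
Proof. by move=> Px K _; apply. Qed.

End Span.

Lemma span_of_sub (F : fieldType) (L : lmodType F) (P Q : L -> Prop) :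
  (forall x, P x -> span_of Q x) -> forall x, span_of P x -> span_of Q x.
Proof. by move=> PQ x; apply=> //; apply: subspace_span. Qed.

Lemma mem_In (T : eqType) (x : T) (s : seq T) : List.In x s <-> x \in s.
Proof.
elim: s => //= y s IH; rewrite inE; split=> [[->|/IH ->]|/orP[/eqP ->|/IH]]; auto.
- by rewrite eqxx.
- by rewrite orbT.
Qed.

Lemma In_map (S T : Type) (f : S -> T) (s : seq S) y :
  List.In y (map f s) -> exists x, y = f x.
Proof. by elim: s => //= x s IH [<-|/IH //]; exists x. Qed.

Lemma fin_dim_span (F : fieldType) (L : lmodType F) (A : L -> Prop) (s : seq L) :
  (forall x, x \in s -> A x) -> (forall x, A x -> span_of (fun y => y \in s) x) ->
  fin_dim A.
Proof.
move=> sA As; exists s; split=> [x /mem_In/sA //|x /As sx].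
apply: (sx (fun x => exists c : 'I_(size s) -> F,
  x = \sum_(i < size s) c i *: nth 0 s i)) => [|y ys].
  split=> [|a u v [c ->] [d ->]].
    by exists (fun=> 0); rewrite big1 // => i _; rewrite scale0r.
  exists (fun i => a * c i + d i); rewrite scaler_sumr -big_split /=.
  by apply: eq_bigr => i _; rewrite scalerDl scalerA.
have iy : (index y s < size s)%N by rewrite index_mem.
exists (fun i => (i == Ordinal iy)%:R); rewrite (bigD1 (Ordinal iy)) //= eqxx scale1r.
by rewrite nth_index // big1 ?addr0 // => j ji; rewrite (negPf ji) scale0r.
Qed.

(** * Iterated brackets of generators *)

Section Words.
Variables (F : fieldType) (L : lmodType F) (br : L -> L -> L).
Hypothesis lieP : lie_bracket br.
Variables (l : nat).

(** Right-normed brackets; the index counts the letters. For the letters [em] the weight is minus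
    the index. *)
Inductive word (e : 'I_l -> L) : 'rV[int]_l -> L -> Prop :=
| word1 i : word e (delta_mx 0 i) (e i)
| wordS i k x : word e k x -> word e (delta_mx 0 i + k) (br (e i) x).

Lemma word_pos e k x : word e k x -> nonneg k /\ k != 0.
Proof.
elim=> [i|i {}k {}x _ [k0 _]]; split.
- by move=> j; rewrite mxE; case: eqP => //= _; case: eqP.
- exact: delta_neq0.
- by move=> j; rewrite !mxE addr_ge0 //; case: eqP => //= _; case: eqP.
- apply/eqP => /rowP /(_ i); rewrite !mxE !eqxx /= => E.
  by have := k0 i; move: E => /eqP; rewrite addrC addr_eq0 => /eqP ->.
Qed.

(** Such a word has the single letter [e i], and [e_i, e_i] = 0 kills it as soon as it has two
    letters. *)
Lemma word_simple e k x i (m : int) : word e k x -> k = m *: delta_mx 0 i ->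
  (m = 1 /\ x = e i) \/ x = 0.
Proof.
move=> w; elim: w i m => [j|j {}k {}x w IH] i m.
  move=> E; left; have /rowP /(_ j) := E; rewrite !mxE !eqxx /=.
  case: eqP => [-> |_]; last by rewrite mulr0.
  by rewrite mulr1 => <-.
have [k0 _] := word_pos w.
move=> E; right; have ji : j = i.
  have /rowP /(_ j) := E; rewrite !mxE !eqxx /=; case: eqP => // _.
  rewrite mulr0 => /eqP; rewrite addrC addr_eq0 => /eqP kj.
  by have := k0 j; rewrite kj.
rewrite -ji in E *; have Ek : k = (m - 1) *: delta_mx 0 j.
  by rewrite scalerBl scale1r -E addrC addKr.
by case: (IH _ _ Ek) => [[_ ->]|->]; rewrite ?(brxx lieP) ?(br0r lieP).
Qed.

Section Lower.
Variables (e f h : 'I_l -> L).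
Hypothesis brf : forall i j, br (e j) (f i) = if i == j then h j else 0.
Hypothesis brh : forall i k y, word f k y -> exists c, br (h i) y = c *: y.

(** Jacobi moves e_j through the letters. Where it meets f_j it leaves h_j, which acts on the rest
    of the word by a scalar or, at the last letter, remains alone. *)
Lemma word_lower j k y : word f k y ->
  span_of (fun z => (exists k, word f k z) \/ exists i, z = h i) (br (e j) y).
Proof.
set S := span_of _; have sS : subspace S by apply: subspace_span.
have Sw k' z : word f k' z -> S z.
  by move=> w; apply: span_gen; left; exists k'.
have Sf i z : S z -> S (br (f i) z).
  move=> Sz; apply: (Sz (fun z => S (br (f i) z))).
    split=> [|a u v Su Sv]; first by rewrite (br0r lieP); case: sS.
    by rewrite (brDr lieP) (brZr lieP); case: sS => _; apply.
  move=> u [[k' w]|[m ->]]; first exact: Sw (wordS i w).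
  have [c E] := brh m (word1 f i); rewrite (brC lieP) E -scaleNr.
  by apply: (subspaceZ sS) => //; exact: Sw (word1 f i).
elim=> [i|i {}k {}y w IH].
  rewrite brf; case: eqP => _; last exact: subspace0 sS.
  by apply: span_gen; right; exists j.
rewrite (brJ lieP) brf; apply: (subspaceD sS) => //; last exact: Sf.
case: eqP => _; last by rewrite (br0l lieP); apply: (subspace0 sS).
have [c ->] := brh j w; apply: (subspaceZ sS) => //; exact: Sw w.
Qed.

End Lower.
End Words.

(** * Triangular decomposition of g *)

Section Chevalley.
Variables (F : fieldType) (L : lmodType F) (br : L -> L -> L) (form : L -> L -> F).
Variable H : L -> Prop.
Variables (l : nat) (t ep em : 'I_l -> L).
Implicit Types (k : 'rV[int]_l).
Hypotheses (RD : root_data br form H) (BD : base_data br form H t).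
Hypothesis epP : forall i, wt br form H (t i) (ep i).
Hypothesis emP : forall i, wt br form H (- t i) (em i).
Local Notation h i := (coroot form (t i)).
Hypothesis epem : forall i, br (ep i) (em i) = h i.
Local Notation wt := (wt br form H).
Local Notation rt := (rt br form H).
Local Notation vec := (vec t).
Local Notation Phi := (Phi br form H t).
Local Notation refl := (refl form t).
Local Notation pairing := (pairing form t).
Let lieP := rd_lie RD.
Let char0 := rd_char RD.

Definition chev_alg := gen_subalg br (fun x => exists i, x = ep i \/ x = em i).
Definition chev_cartan x := exists c : 'I_l -> F, x = \sum_(i < l) c i *: h i.
Local Notation g := chev_alg.
Local Notation hd := chev_cartan.

Lemma t_neq0 i : t i <> 0.
Proof.
by move=> t0; have := t_form_neq0 RD BD i; rewrite t0 (form0l RD) eqxx.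
Qed.

Lemma t_noniso i : form (t i) (t i) <> 0.
Proof. by apply/eqP; apply: (t_form_neq0 RD BD). Qed.

Lemma h_mem i : H (h i).
Proof. by apply: (coroot_mem RD); exact: rt_mem (bd_rt BD i). Qed.

Lemma h_neq0 i : h i <> 0.
Proof.
move/eqP; rewrite scaler_eq0 mulf_eq0 natF_eq0 // invr_eq0 (negPf (t_form_neq0 RD BD i)).
by move/eqP/t_neq0.
Qed.

Lemma form_vec_h k i : form (vec k) (h i) = (pairing (delta_mx 0 i) k)%:~R.
Proof.
rewrite (form_coroot RD); apply: (mulIf (t_form_neq0 RD BD i)).
rewrite mulfVK ?(t_form_neq0 RD BD) //.
by have := pairingE RD BD k (Phi_delta RD BD i); rewrite vec_delta.
Qed.

Lemma chev_sl2 i : sl2_triple br (ep i) (em i) (h i).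
Proof.
split; last exact: epem.
- by rewrite (epP _ (h_mem i)) (form_coroot RD) mulfK ?(t_form_neq0 RD BD).
- rewrite (emP _ (h_mem i)) (formNl RD) (form_coroot RD) mulfK ?(t_form_neq0 RD BD) //.
  by rewrite scaleNr.
Qed.

Lemma ep_neq0 i : ep i <> 0.
Proof. by move=> e0; apply: (@h_neq0 i); rewrite -epem e0 (br0l lieP). Qed.

Lemma em_neq0 i : em i <> 0.
Proof. by move=> e0; apply: (@h_neq0 i); rewrite -epem e0 (br0r lieP). Qed.

Lemma ep_nilp i u : nilp_at br (ep i) u.
Proof. exact (rd_nilp RD (bd_rt BD i) (@t_noniso i) (epP i) u). Qed.

Lemma em_nilp i u : nilp_at br (em i) u.
Proof.
apply: (rd_nilp RD) (emP i) u; first exact (rt_opp RD (bd_rt BD i)).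
by rewrite (formNl RD) (formNr RD) opprK; apply: t_noniso.
Qed.

Lemma chev_subalg : subalgebra br g.
Proof.
split; first split.
- by move=> K [[]].
- by move=> a x y gx gy K sK PK; case: (sK) => [[_ sc] _]; apply: sc; [apply: gx|apply: gy].
- by move=> x y gx gy K sK PK; case: (sK) => _ bc; apply: bc; [apply: gx|apply: gy].
Qed.

Let sg : subspace g := proj1 chev_subalg.

Lemma chev_br x y : g x -> g y -> g (br x y).
Proof. by case: chev_subalg => _; apply. Qed.

Lemma chev_ep i : g (ep i). Proof. by move=> K _; apply; exists i; left. Qed.
Lemma chev_em i : g (em i). Proof. by move=> K _; apply; exists i; right. Qed.
Lemma chev_h i : g (h i).
Proof. by rewrite -epem; apply: chev_br; [apply: chev_ep|apply: chev_em]. Qed.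

Lemma subspace_cartan : subspace hd.
Proof.
split; first by exists (fun=> 0); rewrite big1 // => i _; rewrite scale0r.
move=> a x y [c ->] [d ->]; exists (fun i => a * c i + d i).
rewrite scaler_sumr -big_split /=; apply: eq_bigr => i _.
by rewrite scalerDl scalerA.
Qed.

Lemma cartan_h i : hd (h i).
Proof.
exists (fun j => (j == i)%:R); rewrite (bigD1 i) //= eqxx scale1r big1 ?addr0 // => j ji.
by rewrite (negPf ji) scale0r.
Qed.

Lemma cartan_ind K : subspace K -> (forall i, K (h i)) -> forall x, hd x -> K x.
Proof.
by move=> sK Kh x [c ->]; apply: subspace_sum => // i _; apply: subspaceZ.
Qed.

Lemma cartan_chev x : hd x -> g x.
Proof. by apply: cartan_ind => //; apply: chev_h. Qed.

Lemma cartan_mem x : hd x -> H x.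
Proof. by apply: cartan_ind; [exact: rd_sub RD | exact: h_mem]. Qed.

Lemma wt_h i : wt 0 (h i).
Proof. by rewrite -(subrr (t i)) -epem; apply: (wt_br RD). Qed.

Lemma wt_cartan x : hd x -> wt 0 x.
Proof. by apply: cartan_ind; [apply: subspace_weight | exact: wt_h]. Qed.

Lemma cartan_abelian x y : hd x -> hd y -> br x y = 0.
Proof.
by move=> hx /wt_cartan /(_ x (cartan_mem hx)) ->; rewrite (form0l RD) scale0r.
Qed.

Lemma wt_rt k x : wt (vec k) x -> x <> 0 -> rt (vec k).
Proof. by move=> wx x0; split; [exact: vec_mem RD BD k | exists x]. Qed.

Lemma wt_Phi k x : wt (vec k) x -> x <> 0 -> k != 0 -> Phi k.
Proof. by move=> wx x0; apply: (rt_vec_Phi RD BD); apply: wt_rt wx x0. Qed.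

(** For distinct i and j the weight alpha_j - alpha_i has coefficients of both signs, so it is not
    in [Phi]. *)
Lemma br_ep_em i j : br (ep j) (em i) = if i == j then h j else 0.
Proof.
case: eqP => [->|ij]; first exact: epem.
apply: NNPP => nz; have w : wt (vec (delta_mx 0 j - delta_mx 0 i)) (br (ep j) (em i)).
  by rewrite vecB !vec_delta; apply: (wt_br RD).
have kj : (delta_mx 0 j - delta_mx 0 i : 'rV[int]_l) 0 j = 1.
  by rewrite !mxE !eqxx /= (introF eqP (not_eq_sym ij)) subr0.
have ki : (delta_mx 0 j - delta_mx 0 i : 'rV[int]_l) 0 i = - 1.
  by rewrite !mxE !eqxx /= (introF eqP ij) sub0r.
have k0 : delta_mx 0 j - delta_mx 0 i != 0 :> 'rV[int]_l.
  by apply/eqP => k0; move: kj; rewrite k0 mxE.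
have [/(_ i)|/(_ j)] := Phi_sign RD BD (wt_Phi w nz k0); first by rewrite ki.
by rewrite mxE kj.
Qed.

Lemma word_ep k x : word br ep k x -> wt (vec k) x /\ g x.
Proof.
elim=> [i|i {}k {}x _ [wx gx]]; first by rewrite vec_delta; split=> //; apply: chev_ep.
rewrite vecD vec_delta; split; first exact: wt_br.
by apply: chev_br => //; apply: chev_ep.
Qed.

Lemma word_em k x : word br em k x -> wt (vec (- k)) x /\ g x.
Proof.
elim=> [i|i {}k {}x _ [wx gx]].
  by rewrite vecN vec_delta; split=> //; apply: chev_em.
rewrite opprD vecD {1}vecN vec_delta; split; first exact: wt_br.
by apply: chev_br => //; apply: chev_em.
Qed.

Definition chev_gen y : Prop :=
  [\/ exists k, word br ep k y, exists k, word br em k y | exists i, y = h i].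

Lemma chev_span x : g x -> span_of chev_gen x.
Proof.
set S := span_of _; have sS : subspace S by apply: subspace_span.
have Sp k y : word br ep k y -> S y by move=> w; apply: span_gen; apply: Or31; exists k.
have Sm k y : word br em k y -> S y by move=> w; apply: span_gen; apply: Or32; exists k.
have Sh i : S (h i) by apply: span_gen; apply: Or33; exists i.
have stab u : (forall y, chev_gen y -> S (br u y)) -> forall y, S y -> S (br u y).
  move=> gu y Sy; apply: (Sy (fun z => S (br u z))) => //.
  split=> [|a v w Sv Sw]; first by rewrite (br0r lieP); case: sS.
  by rewrite (brDr lieP) (brZr lieP); case: sS => _; apply.
have Sep i y : S y -> S (br (ep i) y).
  apply: stab => {}y [[k w]|[k w]|[j ->]].
  - exact: Sp (wordS i w).
  - have brh j k' z : word br em k' z -> exists c, br (h j) z = c *: z.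
      by case/word_em => wz _; exists (form (vec (- k')) (h j)); apply: wz; apply: h_mem.
    have lw := word_lower (h := fun j => h j) lieP br_ep_em brh i w.
    apply: (span_of_sub _ lw) => z [[k' w']|[j ->]].
      exact: Sm w'.
    exact: Sh.
  - rewrite (brC lieP) (epP _ (h_mem j)) -scaleNr; apply: (subspaceZ sS) => //.
    exact: Sp (word1 br ep i).
have Sem i y : S y -> S (br (em i) y).
  apply: stab => {}y [[k w]|[k w]|[j ->]].
  (* [word_lower] is used with e and f exchanged, which replaces h by -h. *)
  - have brh j k' z : word br ep k' z -> exists c, br (- h j) z = c *: z.
      case/word_ep => wz _; exists (- form (vec k') (h j)).
      by rewrite (brNl lieP) wz ?scaleNr //; apply: h_mem.
    have bef i' j : br (em j) (ep i') = if i' == j then - h j else 0.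
      by rewrite (brC lieP) br_ep_em eq_sym; case: eqP => [->|_]; rewrite ?oppr0.
    have lw := word_lower (h := fun j => - h j) lieP bef brh i w.
    apply: (span_of_sub _ lw) => z [[k' w']|[j ->]].
      exact: Sp w'.
    by apply: (subspaceN sS) => //; apply: Sh.
  - exact: Sm (wordS i w).
  - rewrite (brC lieP) (emP _ (h_mem j)) -scaleNr; apply: (subspaceZ sS) => //.
    exact: Sm (word1 br em i).
(* By Jacobi the u in S whose ad preserves S form a subalgebra, and it contains the generators. *)
move=> gx; suff [] : S x /\ forall y, S y -> S (br x y) by [].
apply: (gx (fun x => S x /\ forall y, S y -> S (br x y))).
  split; first split.
  - by split=> [|y Sy]; rewrite ?(br0l lieP); apply: (subspace0 sS).
  - move=> a u v [Su au] [Sv av]; split; first by case: sS => _; apply.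
    by move=> y Sy; rewrite (brDl lieP) (brZl lieP); case: sS => _; apply; auto.
  - move=> u v [Su au] [Sv av]; split; first exact: au.
    move=> y Sy; have -> : br (br u v) y = br u (br v y) - br v (br u y).
      by rewrite (brJ lieP u) addrK.
    by apply: (subspaceB sS) => //; auto.
move=> y [i [->|->]]; split; auto.
- exact: Sp (word1 br ep i).
- exact: Sm (word1 br em i).
Qed.

(* The constraints that the triangular decomposition puts on a component of weight [vec k]. *)
Definition chev_comp k x : Prop :=
  [/\ g x, wt (vec k) x, k = 0 -> hd x &
    forall i, [/\ k = delta_mx 0 i -> exists c, x = c *: ep i,
                  k = - delta_mx 0 i -> exists c, x = c *: em i &
                  forall m : int, m \notin [:: 0; 1; - 1] -> k = m *: delta_mx 0 i -> x = 0]].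

Lemma subspace_comp k : subspace (chev_comp k).
Proof.
split.
  split; first exact: subspace0.
  - by move=> u _; rewrite (br0r lieP) scaler0.
  - by move=> _; apply: subspace0 subspace_cartan.
  - by move=> i; split=> // _; exists 0; rewrite scale0r.
move=> a x y [gx wx hx cx] [gy wy hy cy]; split.
- by case: sg => _; apply.
- by case: (subspace_weight lieP H (form (vec k))) => _; apply.
- by move=> k0; case: subspace_cartan => _; apply; auto.
- move=> i; have [x1 x2 x3] := cx i; have [y1 y2 y3] := cy i; split.
  + move=> Ek; have [c ->] := x1 Ek; have [d ->] := y1 Ek.
    by exists (a * c + d); rewrite scalerDl scalerA.
  + move=> Ek; have [c ->] := x2 Ek; have [d ->] := y2 Ek.
    by exists (a * c + d); rewrite scalerDl scalerA.
  + by move=> m m0 Ek; rewrite (x3 m m0 Ek) (y3 m m0 Ek) scaler0 addr0.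
Qed.

Lemma delta_nonneg i : nonneg (delta_mx 0 i : 'rV[int]_l).
Proof. by move=> j; rewrite mxE; case: eqP => //= _; case: eqP. Qed.

Lemma nonneg_antisym k : nonneg k -> nonneg (- k) -> k = 0.
Proof.
move=> k0 k1; apply/rowP => i; apply/eqP; rewrite !mxE eq_le k0 andbT.
by have := k1 i; rewrite mxE oppr_ge0.
Qed.

Lemma comp_gen y : chev_gen y -> exists k, chev_comp k y.
Proof.
case=> [[k w]|[k w]|[i ->]].
- have [k0 kn] := word_pos w; have [wy gy] := word_ep w; exists k; split=> //.
    by move=> E; rewrite E eqxx in kn.
  move=> i; split.
  + move=> Ek; have E1 : k = 1 *: delta_mx 0 i by rewrite scale1r.
    case: (word_simple lieP w E1) => [[_ ->]|->]; first by exists 1; rewrite scale1r.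
    by exists 0; rewrite scale0r.
  + move=> Ek; move: k0; rewrite Ek => k0.
    by case/eqP: (delta_neq0 i); apply: nonneg_antisym => //; apply: delta_nonneg.
  + move=> m m0 Ek; case: (word_simple lieP w Ek) => // [[m1 _]].
    by rewrite m1 in m0.
- have [k0 kn] := word_pos w; have [wy gy] := word_em w; exists (- k); split=> //.
    by move/eqP; rewrite oppr_eq0 (negPf kn).
  move=> i; split.
  + move=> Ek; move: (delta_nonneg i); rewrite -Ek => k1.
    by rewrite (nonneg_antisym k0 k1) eqxx in kn.
  + move=> /oppr_inj Ek; have E1 : k = 1 *: delta_mx 0 i by rewrite scale1r.
    case: (word_simple lieP w E1) => [[_ ->]|->]; first by exists 1; rewrite scale1r.
    by exists 0; rewrite scale0r.
  + move=> m m0 Ek; have Ek' : k = (- m) *: delta_mx 0 i by rewrite scaleNr -Ek opprK.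
    case: (word_simple lieP w Ek') => // [[m1 _]].
    by move: m0; rewrite -[m]opprK m1.
- exists 0; split.
  + exact: chev_h.
  + by rewrite vec0; apply: wt_h.
  + by move=> _; apply: cartan_h.
  + move=> j; split=> [E|E|m m0 E].
    * by case/eqP: (delta_neq0 j).
    * by case/eqP: (delta_neq0 j); rewrite -[LHS]opprK -E oppr0.
    * have /rowP /(_ j) := E; rewrite !mxE !eqxx mulr1 => m00.
      by rewrite -m00 in m0.
Qed.

(** * Weight components of g *)

Section Decomposition.
Variable s : seq 'rV[int]_l.
Hypotheses (us : uniq s) (sP : forall k, k \in s <-> Phi k).

Lemma uniq_0s : uniq (0 :: s).
Proof.
rewrite /= us andbT; apply/negP => /sP /(Phi_neq0 RD BD).
by rewrite eqxx.
Qed.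

Lemma wt_support k x : wt (vec k) x -> x <> 0 -> k \in 0 :: s.
Proof.
move=> wx x0; rewrite inE; case: eqVneq => //= k0.
by apply/sP; apply: wt_Phi wx x0 k0.
Qed.

Lemma comp_decomp x : g x -> exists f : 'rV[int]_l -> L,
  (forall k, chev_comp k (f k)) /\ x = \sum_(k <- 0 :: s) f k.
Proof.
move=> /chev_span gx; apply: (gx (fun x => exists f : 'rV[int]_l -> L,
  (forall k, chev_comp k (f k)) /\ x = \sum_(k <- 0 :: s) f k)).
  split=> [|a u v [f [fc ->]] [f' [fc' ->]]].
    exists (fun=> 0); split; last by rewrite big1.
    by move=> k; case: (subspace_comp k).
  exists (fun k => a *: f k + f' k); split.
    by move=> k; case: (subspace_comp k) => _; apply.
  by rewrite scaler_sumr -big_split.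
move=> y /comp_gen [k ky]; exists (fun k' => if k' == k then y else 0); split.
  by move=> k'; case: eqP => [->|_] //; case: (subspace_comp k').
have [y0|y0] := classic (y = 0); first by rewrite y0 big1 // => k' _; case: ifP.
have ks : k \in 0 :: s by case: ky => _ wy _ _; apply: wt_support wy y0.
rewrite (bigD1_seq k) ?uniq_0s //= eqxx big1 ?addr0 // => k' kk'.
by rewrite (negPf kk').
Qed.

(** The h_i are nonzero multiples of the t_i, so they already detect coordinates by [orth_vecP]. *)
Lemma vec_separated k k' : k != k' ->
  exists x, hd x /\ form (vec k) x <> form (vec k') x.
Proof.
move=> kk'; apply: NNPP => no; case/eqP: kk'; apply/eqP; rewrite -subr_eq0; apply/eqP.
apply: (orth_vecP RD BD) => i; rewrite vecB (formBl RD).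
have E : form (vec k) (h i) = form (vec k') (h i).
  by apply: NNPP => E; apply: no; exists (h i); split=> //; apply: cartan_h.
move/eqP: E; rewrite !(formZr RD) -subr_eq0 -mulrBr mulf_eq0 => /orP[|/eqP //].
by rewrite mulf_eq0 natF_eq0 // invr_eq0 (negPf (t_form_neq0 RD BD i)).
Qed.

Lemma wt_hd k x : wt (vec k) x -> weight_vec br hd (form (vec k)) x.
Proof. by move=> wx y /cartan_mem /wx. Qed.

Lemma comp_in (S : L -> Prop) (f : 'rV[int]_l -> L) k : subspace S ->
  (forall x y, hd x -> S y -> S (br x y)) -> (forall k, wt (vec k) (f k)) ->
  S (\sum_(k <- 0 :: s) f k) -> k \in 0 :: s -> S (f k).
Proof.
move=> sS stS fw; apply: (weight_comp lieP sS stS (w := fun k => form (vec k))).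
- exact: uniq_0s.
- by move=> k' _; apply: wt_hd.
- by move=> k' _ kk'; apply: vec_separated.
Qed.

Lemma comp_eq0 (f : 'rV[int]_l -> L) k : (forall k, wt (vec k) (f k)) ->
  \sum_(k <- 0 :: s) f k = 0 -> k \in 0 :: s -> f k = 0.
Proof.
move=> fw; apply: (comp_in (S := fun x => x = 0)) => //.
  by split=> // a x y -> ->; rewrite scaler0 addr0.
by move=> x y _ ->; rewrite (br0r lieP).
Qed.

(** By independence of weight components, x is its own component in [comp_decomp], whatever its
    expression in generators. *)
Lemma wt_comp k x : g x -> wt (vec k) x -> chev_comp k x.
Proof.
move=> gx wx; have [->|x0] := classic (x = 0); first by case: (subspace_comp k).
have [f [fc Ex]] := comp_decomp gx.
have ks := wt_support wx x0.
suff : f k - (if k == k then x else 0) = 0.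
  by rewrite eqxx => /eqP; rewrite subr_eq0 => /eqP <-.
apply: (@comp_eq0 (fun k' => f k' - (if k' == k then x else 0))) => //.
  move=> k'; apply: (subspaceB (subspace_weight lieP _ _)); first by case: (fc k').
  by case: eqP => [->|_] //; apply: (subspace0 (subspace_weight lieP _ _)).
rewrite sumrB -Ex (bigD1_seq k) ?uniq_0s //= eqxx big1 ?addr0 ?subrr // => k' kk'.
by rewrite (negPf kk').
Qed.

End Decomposition.

Lemma chev_wt_comp k x : g x -> wt (vec k) x -> chev_comp k x.
Proof. by have [s [us sP]] := Phi_finite RD BD; apply: (wt_comp us sP). Qed.

(** * Transport of weight spaces along simple reflections *)

Lemma iter_closed (K : L -> Prop) u n x :
  (forall y, K y -> K (br u y)) -> K x -> K (iter n (br u) x).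
Proof. by move=> Ku Kx; elim: n => //= n; apply: Ku. Qed.

(** For p = <k, alpha_i^vee>, the power |p| of ad f_i or ad e_i, according to the sign of p, acts as
    a simple reflection, injectively by [sl2_string]. It depends only on i and k, so one operator
    serves the whole weight space. *)
Lemma chev_transport i k : exists u n, (u = ep i \/ u = em i) /\
  forall x, wt (vec k) x ->
    wt (vec (refl (delta_mx 0 i) k)) (iter n (br u) x) /\
    (x <> 0 -> iter n (br u) x <> 0).
Proof.
set p := pairing (delta_mx 0 i) k.
have vr : vec (refl (delta_mx 0 i) k) = vec k - p%:~R *: t i.
  by rewrite /refl vecB vecZ vec_delta.
have str x : wt (vec k) x -> x <> 0 ->
    (forall n : nat, n%:Z <= p -> iter n (br (em i)) x <> 0) /\
    (forall n : nat, n%:Z <= - p -> iter n (br (ep i)) x <> 0).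
  move=> wx x0; have [n [cn fs es]] := sl2_string lieP char0 (chev_sl2 i)
    (@ep_nilp i) (@em_nilp i) x0 (wx _ (h_mem i)).
  by move: cn; rewrite form_vec_h => /(intF_inj char0) pn; rewrite /p pn.
have [p0|p0] := leP 0 p.
  exists (em i), (absz p); split=> [|x wx]; first by right.
  split; last by move=> x0; apply: (str x wx x0).1; rewrite gez0_abs.
  have -> : vec (refl (delta_mx 0 i) k) = vec k + (- t i) *+ absz p.
    by rewrite vr mulNrn -scaler_nat pmulrn gez0_abs.
  exact: (wt_iter RD).
exists (ep i), (absz p); split=> [|x wx]; first by left.
split; last by move=> x0; apply: (str x wx x0).2; rewrite ltz0_abs.
have -> : vec (refl (delta_mx 0 i) k) = vec k + (t i) *+ absz p.
  by rewrite vr -scaler_nat pmulrn ltz0_abs // rmorphN /= scaleNr.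
exact: (wt_iter RD).
Qed.

Lemma chev_transport_mem i k (K : L -> Prop) :
  (forall y, K y -> K (br (ep i) y)) -> (forall y, K y -> K (br (em i) y)) ->
  (exists x, [/\ K x, wt (vec k) x & x <> 0]) ->
  exists x, [/\ K x, wt (vec (refl (delta_mx 0 i) k)) x & x <> 0].
Proof.
move=> Ke Kf [x [Kx wx x0]]; have [u [n [uE tr]]] := chev_transport i k.
have [wy /(_ x0) y0] := tr x wx; exists (iter n (br u) x); split=> //.
by apply: iter_closed => // y; case: uE => ->; auto.
Qed.

Lemma chev_weight_refl i k :
  (exists x, [/\ g x, wt (vec k) x & x <> 0]) ->
  exists x, [/\ g x, wt (vec (refl (delta_mx 0 i) k)) x & x <> 0].
Proof.
apply: chev_transport_mem => y gy; apply: chev_br => //.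
  exact: chev_ep.
exact: chev_em.
Qed.

(** At multiples of simple roots [chev_comp] leaves a line or 0; reflections carry this to all of
    [Phi]. *)
Lemma chev_dim1 k : Phi k -> forall x y, g x -> g y -> wt (vec k) x ->
  wt (vec k) y -> x <> 0 -> exists c, y = c *: x.
Proof.
have line (z x y : L) : (exists c, x = c *: z) -> (exists c, y = c *: z) ->
    x <> 0 -> exists c, y = c *: x.
  move=> [c ->] [d ->] cz; exists (d / c); rewrite scalerA mulfVK //.
  by apply/eqP => c0; apply: cz; rewrite c0 scale0r.
move: k; apply: (Phi_ind RD BD) => [i m mm Pm|i k Pk IH] x y gx gy wx wy x0.
  have [_ _ _ /(_ i) [x1 x2 x3]] := chev_wt_comp gx wx.
  have [_ _ _ /(_ i) [y1 y2 y3]] := chev_wt_comp gy wy.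
  have [m1|m1] := eqVneq m 1.
    by apply: (line (ep i)) => //; [apply: x1|apply: y1]; rewrite m1 scale1r.
  have [m2|m2] := eqVneq m (- 1).
    by apply: (line (em i)) => //; [apply: x2|apply: y2]; rewrite m2 scaleN1r.
  case: x0; apply: (x3 m) => //.
  rewrite !inE (negPf m1) (negPf m2) !orbF; apply/eqP => m0.
  by have := Phi_neq0 RD BD Pm; rewrite m0 scale0r eqxx.
have [u [n [uE tr]]] := chev_transport i (refl (delta_mx 0 i) k).
rewrite (reflK RD BD (Phi_delta RD BD i)) in tr.
have gu z : g z -> g (br u z).
  by move=> gz; apply: chev_br => //; case: uE => ->; [apply: chev_ep|apply: chev_em].
have [wx' /(_ x0) x0'] := tr x wx; have [wy' _] := tr y wy.
have [c Ec] := IH _ _ (iter_closed n gu gx) (iter_closed n gu gy) wx' wy' x0'.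
(* The relation between the images lifts: y - c x is sent to 0 by an injective linear map. *)
exists c; apply: NNPP => yx; have wyx : wt (vec (refl (delta_mx 0 i) k)) (y - c *: x).
  by apply: (subspaceB (subspace_weight lieP _ _)) => //; apply: weight_vecZ.
have [_ []] := tr _ wyx; first by move/eqP; rewrite subr_eq0 => /eqP.
have -> : iter n (br u) (y - c *: x) = iter n (br u) y - c *: iter n (br u) x.
  by elim: (n) => //= q ->; rewrite (brDr lieP) (brNr lieP) (brZr lieP).
by rewrite Ec subrr.
Qed.

(** Reflections preserve divisibility by 2 in the lattice, and at m alpha_i only the odd values m =
    1, -1 carry vectors of g. *)
Lemma chev_reduced k : Phi k -> (exists x, [/\ g x, wt (vec k) x & x <> 0]) ->
  forall k', k <> k' + k'.
Proof.
move: k; apply: (Phi_ind RD BD) => [i m mm Pm|i k Pk IH] ex k' Ek; last first.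
  have Pd := Phi_delta RD BD i; have := chev_weight_refl i ex.
  rewrite (reflK RD BD Pd) => /IH /(_ (refl (delta_mx 0 i) k')); apply.
  by rewrite -(reflD RD BD) // -Ek (reflK RD BD Pd).
have [x [gx wx x0]] := ex; have [_ _ _ /(_ i) [_ _ x3]] := chev_wt_comp gx wx.
have mk : m = k' 0 i + k' 0 i by have /rowP /(_ i) := Ek; rewrite !mxE !eqxx mulr1.
case: x0; apply: (x3 m) => //; rewrite !inE; apply/negP => /or3P[] /eqP m1.
- by have := Phi_neq0 RD BD Pm; rewrite m1 scale0r eqxx.
- by move: mk; rewrite m1; move: (k' 0 i) => q; lia.
- by move: mk; rewrite m1; move: (k' 0 i) => q; lia.
Qed.

(** At m alpha_i, e_i and f_i serve m = 1, -1, and m = 2, -2 give doubles; reflections preserve both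
    alternatives. *)
Lemma chev_root_or_double k : Phi k -> (exists2 k', Phi k' & k = k' + k') \/
  exists x, [/\ g x, wt (vec k) x & x <> 0].
Proof.
move: k; apply: (Phi_ind RD BD) => [i m mm Pm|i k Pk]; last first.
  have Pd := Phi_delta RD BD i.
  case=> [[k' Pk' ->]|ex]; last by right; apply: chev_weight_refl.
  left; exists (refl (delta_mx 0 i) k'); first exact: (Phi_refl RD BD).
  exact: (reflD RD BD).
move: mm; rewrite !inE => /or4P[] /eqP ->.
- right; exists (ep i); rewrite scale1r vec_delta.
  by split; [apply: chev_ep | apply: epP | apply: ep_neq0].
- right; exists (em i); rewrite scaleN1r vecN vec_delta.
  by split; [apply: chev_em | apply: emP | apply: em_neq0].
- left; exists (delta_mx 0 i); first exact: (Phi_delta RD BD).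
  by rewrite scaler_nat mulr2n.
- left; exists (- delta_mx 0 i); first exact: PhiN (Phi_delta RD BD i).
  by rewrite scaleNr scaler_nat mulr2n opprD.
Qed.

(** * Ideals of g *)

Section Ideal.
Variable I : L -> Prop.
Hypothesis idI : ideal br g I.

Let subI : subspace I := proj1 idI.

Lemma ideal_br x y : g x -> I y -> I (br x y).
Proof. by case: idI => _ [_]; apply. Qed.

Lemma ideal_brr x y : g y -> I x -> I (br x y).
Proof. by move=> gy Ix; rewrite (brC lieP); apply: subspaceN subI _ (ideal_br gy Ix). Qed.

Lemma ideal_h_ep i : I (h i) -> I (ep i) /\ I (em i).
Proof.
move=> Ih; have [he hf _] := chev_sl2 i; have two := twoF_neq0 char0; split.
  rewrite -[ep i](scalerK two) -he; apply: (subspaceZ subI).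
  by apply: ideal_brr => //; apply: chev_ep.
rewrite -[em i](scalerK two); apply: (subspaceZ subI).
rewrite -[2 *: em i]opprK -hf; apply: (subspaceN subI).
by apply: ideal_brr => //; apply: chev_em.
Qed.

Lemma ideal_ep_h i : I (ep i) -> I (h i).
Proof. by move=> Ie; rewrite -epem; apply: ideal_brr => //; apply: chev_em. Qed.

Lemma ideal_em_h i : I (em i) -> I (h i).
Proof. by move=> Ie; rewrite -epem; apply: ideal_br => //; apply: chev_ep. Qed.

(** The operators of [chev_transport] preserve I, so the weight moves to a multiple of a simple
    root; there x is proportional to e_i or f_i, and one bracket yields h_i. *)
Lemma ideal_weight k : Phi k -> (exists x, [/\ I x, wt (vec k) x & x <> 0]) ->
  exists i, I (h i).
Proof.
move: k; apply: (Phi_ind RD BD) => [i m mm Pm [x [Ix wx x0]]|i k Pk IH ex]; last first.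
  apply: IH; rewrite -[k](reflK RD BD (Phi_delta RD BD i)).
  by apply: chev_transport_mem ex => y Iy; apply: ideal_br => //;
    [apply: chev_ep|apply: chev_em].
have gx : g x by case: idI => _ [Ig _]; apply: Ig.
have inI z : (exists c, x = c *: z) -> I z.
  case=> c Ec; have c0 : c != 0 by apply/eqP => c0; apply: x0; rewrite Ec c0 scale0r.
  by rewrite -[z](scalerK c0) -Ec; apply: (subspaceZ subI).
have [_ _ _ /(_ i) [x1 x2 x3]] := chev_wt_comp gx wx; exists i.
have [m1|m1] := eqVneq m 1.
  by apply: ideal_ep_h; apply: inI; apply: x1; rewrite m1 scale1r.
have [m2|m2] := eqVneq m (- 1).
  by apply: ideal_em_h; apply: inI; apply: x2; rewrite m2 scaleN1r.
case: x0; apply: (x3 m) => //.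
rewrite !inE (negPf m1) (negPf m2) !orbF; apply/eqP => m0.
by have := Phi_neq0 RD BD Pm; rewrite m0 scale0r eqxx.
Qed.

(** If (x, t_j) is nonzero, [x, e_j] = (x, t_j) e_j puts e_j in I; if all of them vanish,
    [gram_nondeg] gives x = 0. *)
Lemma ideal_cartan x : I x -> hd x -> x <> 0 -> exists i, I (h i).
Proof.
move=> Ix hx x0; apply: NNPP => no; apply: x0.
have orthx j : form x (t j) = 0.
  apply: NNPP => /eqP fx; apply: no; exists j; apply: ideal_ep_h.
  rewrite -[ep j](scalerK fx); apply: (subspaceZ subI).
  rewrite (formC RD) -(epP _ (cartan_mem hx)).
  by apply: ideal_brr => //; apply: chev_ep.
have [c Ec] := hx.
have E0 j : \sum_i (c i * (2 / form (t i) (t i))) * form (t i) (t j) = 0.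
  transitivity (form x (t j)); last exact: orthx.
  rewrite Ec (form_suml RD); apply: eq_bigr => i _.
  by rewrite !(formZl RD) mulrA.
rewrite Ec big1 // => i _.
by rewrite scalerA (gram_nondeg RD BD E0) scale0r.
Qed.

Lemma ideal_meets_h x : I x -> x <> 0 -> exists i, I (h i).
Proof.
move=> Ix x0; have [s [us sP]] := Phi_finite RD BD.
have gx : g x by case: idI => _ [Ig _]; apply: Ig.
have [f [fc Ex]] := comp_decomp us sP gx.
have [k [ks fk0]] : exists k, k \in 0 :: s /\ f k <> 0.
  apply: NNPP => no; apply: x0; rewrite Ex big1_seq // => k /andP[_ ks].
  by apply: NNPP => fk; apply: no; exists k.
have fw k' : wt (vec k') (f k') by case: (fc k').
have Ifk : I (f k).
  rewrite Ex in Ix; apply: (comp_in us sP subI _ fw Ix ks).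
  by move=> u v /cartan_chev gu; apply: ideal_br.
have [_ _ hk _] := fc k.
have [k0|k0] := eqVneq k 0; first exact: ideal_cartan Ifk (hk k0) fk0.
by apply: (ideal_weight (wt_Phi (fw k) fk0 k0)); exists (f k).
Qed.

Hypothesis irr : forall P : L -> Prop,
  (exists a, [/\ rt a, form a a <> 0 & P a]) ->
  (exists b, [/\ rt b, form b b <> 0 & ~ P b]) ->
  exists a b, [/\ rt a, form a a <> 0 & P a] /\
              [/\ rt b, form b b <> 0, ~ P b & form a b <> 0].

(** Otherwise every element of [Phi] is supported in J or outside J: this holds at multiples of
    simple roots, and a simple reflection from the other side acts trivially. The nonisotropic roots
    then split orthogonally, against [irr]. *)
Lemma base_connected (J : 'I_l -> Prop) : (exists i, J i) ->
  (forall i j, J i -> ~ J j -> form (t i) (t j) = 0) -> forall i, J i.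
Proof.
move=> [i0 Ji0] orthJ j0; apply: NNPP => Jj0.
pose inJ k := forall i, ~ J i -> k 0 i = 0.
pose outJ k := forall i, J i -> k 0 i = 0.
have orth_in k i : inJ k -> ~ J i -> form (vec k) (t i) = 0.
  move=> kJ Ji; rewrite (form_suml RD) big1 // => j _; rewrite (formZl RD).
  have [Jj|Jj] := classic (J j); first by rewrite orthJ ?mulr0.
  by rewrite kJ // mul0r.
have orth_out k i : outJ k -> J i -> form (vec k) (t i) = 0.
  move=> kJ Ji; rewrite (form_suml RD) big1 // => j _; rewrite (formZl RD).
  have [Jj|Jj] := classic (J j); first by rewrite kJ // mul0r.
  by rewrite (formC RD) orthJ ?mulr0.
have pair0 k i : form (vec k) (t i) = 0 -> refl (delta_mx 0 i) k = k.
  move=> E; rewrite /refl (@pairing_uniq _ _ _ _ _ _ _ RD BD _ _ 0).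
  - by rewrite scale0r subr0.
  - exact: Phi_delta RD BD i.
  - by rewrite vec_delta E mul0r mulr0.
have split_Phi : forall k, Phi k -> inJ k \/ outJ k.
  apply: (Phi_ind RD BD) => [i m _ _|i k Pk].
    have off j : j != i -> (m *: delta_mx 0 i : 'rV[int]_l) 0 j = 0.
      by move=> ji; rewrite !mxE (negPf ji) andbF mulr0.
    by have [Ji|Ji] := classic (J i); [left|right] => j Jj; apply: off;
      apply/eqP => E; rewrite E in Jj.
  have off j : j != i -> refl (delta_mx 0 i) k 0 j = k 0 j.
    by move=> ji; rewrite /refl !mxE (negPf ji) andbF mulr0 subr0.
  have [Ji|Ji] := classic (J i); case=> kJ.
  - left=> j Jj; rewrite off ?kJ //; apply/eqP => E; by rewrite E in Jj.
  - by right; rewrite pair0 //; apply: orth_out.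
  - by left; rewrite pair0 //; apply: orth_in.
  - right=> j Jj; rewrite off ?kJ //; apply/eqP => E; by rewrite E in Jj.
pose P a := exists k, orth br form H (a - vec k) /\ inJ k.
have od i : orth br form H (t i - vec (delta_mx 0 i)).
  by rewrite vec_delta subrr; case: (subspace_orth RD).
have [||a [b [[ra na [k [ok kJ]]] [rb nb nPb ab]]]] := irr (P := P).
- exists (t i0); split; [exact: bd_rt BD i0 | exact: t_noniso | exists (delta_mx 0 i0)].
  split=> // i Ji; rewrite mxE /=; case: eqP => // E; by rewrite E in Ji.
- exists (t j0); split; [exact: bd_rt BD j0 | exact: t_noniso |] => -[k [ok kJ]].
  have := kJ _ Jj0; rewrite -(coord_uniq RD BD (od j0) ok) mxE !eqxx; lia.
apply: ab; have [k' [_ ok']] := bd_coord BD rb.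
rewrite (form_coord RD BD rb ok ok').
have [k'J|k'J] : inJ k' \/ outJ k' by apply: split_Phi; exists b.
  by case: nPb; exists k'.
rewrite (formC RD) (form_suml RD) big1 // => i _; rewrite (formZl RD).
have [Ji|Ji] := classic (J i); first by rewrite k'J // mul0r.
by rewrite (formC RD) orth_in ?mulr0.
Qed.

(** If h_i is in I and (t_i, t_j) is nonzero, [h_i, e_j] is a nonzero multiple of e_j, so h_j is in
    I. By [base_connected] all h_i, hence all generators, lie in I. *)
Lemma ideal_full x : I x -> x <> 0 -> forall y, g y -> I y.
Proof.
move=> Ix x0; have Jall : forall i, I (h i).
  apply: base_connected (ideal_meets_h Ix x0) _ => i j Ii Ij.
  apply: NNPP => /eqP fij; apply: Ij; apply: ideal_ep_h.
  have c0 : form (t j) (h i) != 0.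
    rewrite (formZr RD) (formC RD) !mulf_neq0 ?natF_eq0 ?invr_eq0 //.
    exact: (t_form_neq0 RD BD).
  rewrite -[ep j](scalerK c0) -(epP _ (h_mem i)); apply: (subspaceZ subI).
  by apply: ideal_brr => //; apply: chev_ep.
move=> y; apply => [|z [i [->|->]]].
- split=> // u v Iu Iv; apply: ideal_br => //; by case: idI => _ [Ig _]; apply: Ig.
- by case: (ideal_h_ep (Jall i)).
- by case: (ideal_h_ep (Jall i)).
Qed.

End Ideal.

(** * Simplicity, dimension, Cartan subalgebra and weights of g *)

Lemma chev_simple (i0 : 'I_l) :
  (forall P : L -> Prop,
    (exists a, [/\ rt a, form a a <> 0 & P a]) ->
    (exists b, [/\ rt b, form b b <> 0 & ~ P b]) ->
    exists a b, [/\ rt a, form a a <> 0 & P a] /\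
                [/\ rt b, form b b <> 0, ~ P b & form a b <> 0]) ->
  simple_lie br g.
Proof.
move=> irr; split; [exact: chev_subalg | split].
  exists (ep i0), (em i0); split; first exact: chev_ep.
  by split; [exact: chev_em | rewrite epem; apply: h_neq0].
move=> I idI; have [[x [Ix x0]]|no] := classic (exists x, I x /\ x <> 0).
  by right; apply: (ideal_full idI irr Ix x0).
by left=> x Ix; apply: NNPP => x0; apply: no; exists x.
Qed.

Lemma chev_fin_dim : fin_dim g.
Proof.
have [s [us sP]] := Phi_finite RD BD.
pose gens k v := [/\ g v & forall y, g y -> wt (vec k) y -> exists c, y = c *: v].
(* An element of g whose multiples cover the weight space of k; any element of g qualifies if that
   space is 0. *)
pose v k := epsilon (inhabits (0 : L)) (gens k).
have vP k : Phi k -> gens k (v k).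
  move=> Pk; apply: (epsilon_spec (inhabits (0 : L)) (gens k)).
  have [[x [gx wx x0]]|no] := classic (exists x, [/\ g x, wt (vec k) x & x <> 0]).
    by exists x; split=> // y gy wy; apply: (chev_dim1 Pk).
  exists 0; split; first exact: subspace0.
  move=> y gy wy; exists 0; rewrite scaler0; apply: NNPP => y0; apply: no.
  by exists y.
apply: (@fin_dim_span _ _ _ ([seq h i | i <- enum 'I_l] ++ [seq v k | k <- s])).
  move=> x; rewrite mem_cat => /orP[/mapP[i _ ->]|/mapP[k /sP /vP[gv _] ->]] //.
  exact: chev_h.
move=> x /(comp_decomp us sP)[f [fc ->]].
apply: subspace_sum; first exact: subspace_span.
move=> k; have [gf wf hf _] := fc k; rewrite inE.
have [k0 _|k0 /= ks] := eqVneq k 0.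
  apply: cartan_ind (hf k0); first exact: subspace_span.
  move=> i; apply: span_gen; rewrite mem_cat; apply/orP; left; apply/mapP.
  by exists i; rewrite ?mem_enum.
have [_ /(_ _ gf wf) [c ->]] := vP k ((sP k).1 ks).
apply: (subspaceZ (subspace_span _)).
by apply: span_gen; rewrite mem_cat (map_f _ ks) orbT.
Qed.

Lemma h_independent (c : 'I_l -> F) :
  \sum_(i < l) c i *: h i = 0 -> forall i, c i = 0.
Proof.
move=> Ec i.
have E0 j : \sum_i (c i * (2 / form (t i) (t i))) * form (t i) (t j) = 0.
  transitivity (form (\sum_(i < l) c i *: h i) (t j)); last by rewrite Ec (form0l RD).
  by rewrite (form_suml RD); apply: eq_bigr => m _; rewrite !(formZl RD) mulrA.
have /eqP := gram_nondeg RD BD E0 i.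
rewrite !mulf_eq0 natF_eq0 // invr_eq0 (negPf (t_form_neq0 RD BD i)) !orbF.
by move/eqP.
Qed.

Lemma vec_nonzero k : k != 0 -> exists x, hd x /\ form (vec k) x <> 0.
Proof.
by move/vec_separated => [x [hx]]; rewrite vec0 (form0l RD); exists x.
Qed.

Lemma wt_eq0 k y : k != 0 -> wt (vec k) y -> (forall x, hd x -> br x y = 0) -> y = 0.
Proof.
move=> /vec_nonzero [x [hx /eqP kx]] wy xy; have := wy x (cartan_mem hx).
by rewrite xy // => /esym/eqP; rewrite scaler_eq0 (negPf kx) => /eqP.
Qed.

(** If x normalizes [hd], each component of [u, x] with u in [hd] lies in [hd]. At a nonzero weight
    it is killed by the abelian [hd], hence is 0; so [hd] kills f k, which is then 0 as well. *)
Lemma chev_self_normalizing : self_normalizing br hd g.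
Proof.
move=> x gx nx; have [s [us sP]] := Phi_finite RD BD.
have [f [fc Ex]] := comp_decomp us sP gx.
have fw k : wt (vec k) (f k) by case: (fc k).
suff f0 k : k \in 0 :: s -> k != 0 -> f k = 0.
  have [_ _ /(_ erefl) hf0 _] := fc 0.
  rewrite Ex big_cons big1_seq ?addr0 // => k /andP[_ ks].
  apply: f0; first by rewrite inE ks orbT.
  by apply: (Phi_neq0 RD BD); apply/sP.
move=> ks k0; have stab u v : hd u -> hd v -> hd (br u v).
  by move=> hu hv; rewrite cartan_abelian //; case: subspace_cartan.
have xf u : hd u -> br u (f k) = 0.
  move=> hu; rewrite (fw k u (cartan_mem hu)).
  have wf k' : wt (vec k') (form (vec k') u *: f k') by apply: (weight_vecZ lieP); apply: fw.
  have sum_hd : hd (\sum_(k' <- 0 :: s) form (vec k') u *: f k').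
    have -> : \sum_(k' <- 0 :: s) form (vec k') u *: f k' = - br x u.
      rewrite (brC lieP) opprK Ex (br_sumr lieP); apply: eq_bigr => k' _.
      by rewrite (fw k' u (cartan_mem hu)).
    by apply: (subspaceN subspace_cartan); apply: nx.
  have hf := comp_in us sP subspace_cartan stab wf sum_hd ks.
  by apply: (wt_eq0 k0 (wf k)) => w hw; apply: cartan_abelian.
exact: wt_eq0 k0 (fw k) xf.
Qed.

Lemma chev_toral (i0 : 'I_l) : toral br hd g.
Proof.
split; first split; first exact: subspace_cartan.
  by move=> x y hx hy; rewrite cartan_abelian //; case: subspace_cartan.
split; first exact: cartan_chev.
split; first by exists (h i0); split; [apply: cartan_h | apply: h_neq0].
move=> x gx; have [s [us sP]] := Phi_finite RD BD.
have [f [fc ->]] := comp_decomp us sP gx.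
exists [seq (form (vec k), f k) | k <- 0 :: s]; split; last by rewrite big_map.
move=> p pin; have [k ->] := In_map pin; have [gf wf _ _] := fc k.
by split=> // u /cartan_mem; apply: wf.
Qed.

Lemma cartan_nilpotent : nilpotent_sub br hd.
Proof.
exists 1%N => x [|y []] //= _ hx hy.
by apply: cartan_abelian => //; apply: hy; left.
Qed.

(** Comparing components of a vector of weight b shows that b agrees on [hd] with every k whose
    component is nonzero. The zero weight is realized by the vector h of index i0. *)
Lemma chev_weights (i0 : 'I_l) (b : L -> F) :
  (exists y, y <> 0 /\ wsp br hd g b y) <->
  (forall x, hd x -> b x = 0) \/
  exists k, [/\ Phi k, exists x, [/\ g x, wt (vec k) x & x <> 0] &
                forall x, hd x -> b x = form (vec k) x].
Proof.
split=> [[y [y0 [gy wy]]]|[b0|[k [Pk [x [gx wx x0]] bk]]]]; last first.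
- exists x; split=> //; split=> // u hu; rewrite bk //; exact: wx (cartan_mem hu).
- exists (h i0); split; [exact: h_neq0 | split; first exact: chev_h].
  by move=> u hu; rewrite b0 // scale0r cartan_abelian //; apply: cartan_h.
have [s [us sP]] := Phi_finite RD BD.
have [f [fc Ey]] := comp_decomp us sP gy.
have fw k : wt (vec k) (f k) by case: (fc k).
have [k [ks fk0]] : exists k, k \in 0 :: s /\ f k <> 0.
  apply: NNPP => no; apply: y0; rewrite Ey big1_seq // => k /andP[_ ks].
  by apply: NNPP => fk; apply: no; exists k.
have bk x : hd x -> b x = form (vec k) x.
  move=> hx; have wf k' : wt (vec k') ((form (vec k') x - b x) *: f k').
    by apply: (weight_vecZ lieP); apply: fw.
  have /(comp_eq0 us sP wf) : \sum_(k' <- 0 :: s) (form (vec k') x - b x) *: f k' = 0.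
    have -> : \sum_(k' <- 0 :: s) (form (vec k') x - b x) *: f k' = br x y - b x *: y.
      rewrite Ey (br_sumr lieP) scaler_sumr -sumrB; apply: eq_bigr => k' _.
      by rewrite (fw k' x (cartan_mem hx)) scalerBl.
    by rewrite wy // subrr.
  move=> /(_ k ks) /eqP; rewrite scaler_eq0 subr_eq0 => /orP[/eqP -> //|/eqP //].
have [k0|k0] := eqVneq k 0.
  by left=> x hx; rewrite bk // k0 vec0 (form0l RD).
right; exists k; split=> //; first exact: wt_Phi (fw k) fk0 k0.
by exists (f k); split=> //; case: (fc k).
Qed.

End Chevalley.

(** * From linear functionals to vectors *)

Section Riesz.
Variables (F : fieldType) (L : lmodType F) (br : L -> L -> L) (form : L -> L -> F).
Variable H : L -> Prop.
Hypotheses (formP : invariant_form br form) (subH : subspace H).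
Hypotheses (fdH : fin_dim H) (ndH : nondeg_on form H).

Lemma lin_on0 a : lin_on H a -> a 0 = 0.
Proof.
move=> la; have := la 1 0 0 (subspace0 subH) (subspace0 subH).
by rewrite scale1r addr0 mul1r => E; apply: (addrI (a 0)); rewrite addr0 -E.
Qed.

Lemma lin_on_sum a (n : nat) (c : 'I_n -> F) (x : 'I_n -> L) : lin_on H a ->
  (forall i, H (x i)) -> a (\sum_i c i *: x i) = \sum_i c i * a (x i).
Proof.
move=> la Hx; elim: (index_enum _) => [|i s IH]; first by rewrite !big_nil lin_on0.
rewrite !big_cons la ?IH //; apply: subspace_sum => // j _.
exact: subspaceZ.
Qed.

(** For the Gram matrix G of a spanning family, solve d G = r. A cokernel column of G gives a
    combination of the family orthogonal to H, hence zero, so a vanishes on it and the system is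
    solvable. *)
Lemma riesz a : lin_on H a -> exists t, H t /\ forall x, H x -> form t x = a x.
Proof.
move=> la; have [s [sH Hs]] := fdH; set n := size s.
have sHi (i : 'I_n) : H (nth 0 s i) by apply: sH; apply/mem_In; apply: mem_nth.
pose G : 'M[F]_n := \matrix_(i, j) form (nth 0 s i) (nth 0 s j).
pose r : 'rV[F]_n := \row_j a (nth 0 s j).
have : (r <= G)%MS.
  rewrite submxE; apply/eqP/rowP => k; rewrite [RHS]mxE.
  pose v := \sum_(j < n) cokermx G j k *: nth 0 s j.
  have Hv : H v by apply: (subspace_sum subH) => j _; apply: (subspaceZ subH).
  have v0 : v = 0.
    apply: ndH => // y Hy; have [c ->] := Hs y Hy.
    rewrite (formC formP) (form_suml formP) big1 // => i _.
    rewrite (formZl formP) (formC formP) (form_suml formP).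
    have /matrixP /(_ i k) := mulmx_coker G; rewrite !mxE => E.
    rewrite -[RHS](mulr0 (c i)) -[in RHS]E; congr (_ * _); apply: eq_bigr => j _.
    by rewrite (formZl formP) (formC formP) mulrC [G i j]mxE.
  have := lin_on_sum (fun j => cokermx G j k) la sHi.
  rewrite -/v v0 lin_on0 // => E; rewrite mxE [RHS]E.
  by apply: eq_bigr => j _; rewrite mxE mulrC.
move=> /submxP [d rd]; exists (\sum_i d 0 i *: nth 0 s i); split.
  by apply: (subspace_sum subH) => j _; apply: (subspaceZ subH).
move=> x /Hs [c ->]; rewrite [RHS]lin_on_sum // (formC formP) (form_suml formP).
apply: eq_bigr => j _; rewrite (formZl formP); congr (_ * _).
have /rowP /(_ j) := rd; rewrite !mxE => ->.
rewrite (formC formP) (form_suml formP); apply: eq_bigr => i _.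
by rewrite (formZl formP) mxE.
Qed.

Lemma tvecP a : lin_on H a ->
  H (tvec form H a) /\ forall x, H x -> form (tvec form H a) x = a x.
Proof.
move=> /riesz; apply: (epsilon_spec (inhabits (0 : L))
  (fun t => H t /\ forall h, H h -> form t h = a h)).
Qed.

Lemma form_lin_on t : lin_on H (form t).
Proof. by move=> a x y _ _; rewrite (formDr formP) (formZr formP). Qed.

Lemma lin_on_ext a b : (forall x, H x -> a x = b x) -> lin_on H b -> lin_on H a.
Proof.
move=> ab lb c x y Hx Hy; rewrite !ab ?lb //; apply: (subspaceD subH) => //.
exact: (subspaceZ subH).
Qed.

Lemma form_inj_on t t' : H t -> H t' -> (forall x, H x -> form t x = form t' x) -> t = t'.
Proof.
move=> Ht Ht' tt; apply/eqP; rewrite -subr_eq0; apply/eqP.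
apply: ndH => [|x Hx]; first exact: (subspaceB subH).
by rewrite (formBl formP) tt // subrr.
Qed.

Lemma tvec_eq t a : H t -> (forall x, H x -> a x = form t x) -> tvec form H a = t.
Proof.
move=> Ht at_; have [Hu ua] := tvecP (lin_on_ext at_ (@form_lin_on t)).
by apply: form_inj_on => // x Hx; rewrite ua // at_.
Qed.

Lemma tvec_form t : H t -> tvec form H (form t) = t.
Proof. by move=> Ht; apply: tvec_eq. Qed.

Lemma wsp_wt a x : lin_on H a -> wsp br H (fun _ => True) a x ->
  wt br form H (tvec form H a) x.
Proof. by move=> /tvecP[_ Ea] [_ ax] h Hh; rewrite Ea // ax. Qed.

Lemma wt_wsp t x : wt br form H t x -> wsp br H (fun _ => True) (form t) x.
Proof. by split. Qed.

Lemma is_root_rt a : is_root br H a -> rt br form H (tvec form H a).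
Proof.
case=> la [x [x0 ax]]; split; first by case: (tvecP la).
by exists x; split=> //; apply: wsp_wt.
Qed.

Lemma rt_is_root t : rt br form H t -> is_root br H (form t).
Proof. by case=> Ht [x [x0 tx]]; split; [apply: form_lin_on | exists x]. Qed.

Lemma rform_form t t' : H t -> H t' -> rform form H (form t) (form t') = form t t'.
Proof. by move=> Ht Ht'; rewrite /rform !tvec_form. Qed.

Lemma orth_roots_orth a : lin_on H a ->
  orth_roots br form H a <-> orth br form H (tvec form H a).
Proof.
move=> la; split=> oa r rr.
  by have := oa _ (rt_is_root rr); rewrite /rform tvec_form //; case: rr.
exact: oa (is_root_rt rr).
Qed.

End Riesz.

(** * Axioms, base and R-dot in terms of vectors *)

Section ClassT.
Variables (F : fieldType) (L : lmodType F) (br : L -> L -> L) (form : L -> L -> F).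
Variable H : L -> Prop.
Hypothesis T : class_T br form H.

Lemma class_T_form : invariant_form br form.
Proof. by case: T => _ [_ [? _]]. Qed.

Lemma class_T_sub : subspace H.
Proof. by case: T => _ [_ [_ [_ [[[? _] _] _]]]]. Qed.

Lemma class_T_fin_dim : fin_dim H.
Proof. by case: T => _ [_ [_ [_ [_ [? _]]]]]. Qed.

Lemma class_T_nondeg : nondeg_on form H.
Proof. by case: T => _ [_ [_ [_ [_ [_ [? _]]]]]]. Qed.

Let formP := class_T_form.
Let subH := class_T_sub.
Let fdH := class_T_fin_dim.
Let ndH := class_T_nondeg.
Let tvec_form := tvec_form formP subH fdH ndH.
Let rform_form := rform_form formP subH fdH ndH.

Lemma rt_Rx t : rt br form H t -> form t t <> 0 -> Rx br form H (form t).
Proof.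
by move=> rr nt; split; [exact: (rt_is_root formP) | rewrite rform_form //; case: rr].
Qed.

Lemma rt_R0 t : rt br form H t -> form t t = 0 -> R0 br form H (form t).
Proof.
by move=> rr nt; split; [exact: (rt_is_root formP) | rewrite rform_form //; case: rr].
Qed.

Lemma wsp_opp_wt t y : wsp br H (fun _ => True) (fun z => - form t z) y ->
  wt br form H (- t) y.
Proof. by case=> _ wy h Hh; rewrite wy // (formNl formP). Qed.

Lemma class_T_root_data : root_data br form H.
Proof.
case: T => ch [lie [_ [_ [_ [_ [_ [t3a [t3b [t4 [_ [t5b _]]]]]]]]]]].
split=> //.
- move=> d rd id; have [x [y [wx [wy xy]]]] := t3a _ (rt_R0 rd id).
  exists x, y; split; [by case: wx | exact: wsp_opp_wt |].
  by rewrite xy tvec_form //; case: rd.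
- move=> a x ra na wx x0; have [y [wy xy]] := t3b _ (rt_Rx ra na) x (wt_wsp wx) x0.
  exists y; split; first exact: wsp_opp_wt.
  by rewrite xy tvec_form //; case: ra.
- move=> a x ra na wx y; exact: t4 (rt_Rx ra na) (wt_wsp wx) y.
- move=> d rd id; have [a [[ra na] rad]] := t5b _ (rt_R0 rd id).
  exists (tvec form H a); split=> //; first exact: is_root_rt ra.
  have := is_root_rt formP subH fdH ndH rad; congr (rt _ _ _ _).
  have [Ha Ea] := tvecP formP subH fdH ndH ra.1.
  apply: (tvec_eq formP subH fdH ndH); first by apply: (subspaceD subH) => //; case: rd.
  by move=> x Hx; rewrite (formDl formP) Ea.
Qed.

Lemma class_T_irr (P : L -> Prop) :
  (exists a, [/\ rt br form H a, form a a <> 0 & P a]) ->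
  (exists b, [/\ rt br form H b, form b b <> 0 & ~ P b]) ->
  exists a b, [/\ rt br form H a, form a a <> 0 & P a] /\
              [/\ rt br form H b, form b b <> 0, ~ P b & form a b <> 0].
Proof.
move=> [a [ra na Pa]] [b [rb nb Pb]].
case: T => _ [_ [_ [_ [_ [_ [_ [_ [_ [_ [t5a _]]]]]]]]]].
apply: NNPP => no.
apply: (t5a (fun x => Rx br form H x /\ P (tvec form H x))
            (fun x => Rx br form H x /\ ~ P (tvec form H x))).
- by move=> x; split=> [Rxx|[[]|[]]] //; case: (classic (P (tvec form H x))); auto.
- by move=> x [[_ Px] [_ nPx]].
- by exists (form a); split; [exact: rt_Rx | rewrite tvec_form //; case: ra].
- by exists (form b); split; [exact: rt_Rx | rewrite tvec_form //; case: rb].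
- move=> x y [[rx nx] Px] [[ry ny] Py]; apply: NNPP => xy; apply: no.
  have rtx := is_root_rt formP subH fdH ndH rx.
  have rty := is_root_rt formP subH fdH ndH ry.
  by exists (tvec form H x), (tvec form H y).
Qed.

Variables (l : nat) (ad : 'I_l -> L -> F).
Hypothesis base : std_base br form H ad.
Local Notation t := (fun i => tvec form H (ad i)).
Let RD := class_T_root_data.

Lemma ad_lin i : lin_on H (ad i).
Proof. by case: base => /(_ i)[]. Qed.

Lemma t_mem i : H (tvec form H (ad i)).
Proof. by case: (tvecP formP subH fdH ndH (ad_lin i)). Qed.

Lemma form_t i x : H x -> form (tvec form H (ad i)) x = ad i x.
Proof. by case: (tvecP formP subH fdH ndH (ad_lin i)) => _; apply. Qed.

Lemma form_t_sum (c : 'I_l -> F) x : H x ->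
  form (\sum_i c i *: tvec form H (ad i)) x = \sum_i c i * ad i x.
Proof.
move=> Hx; rewrite (form_suml formP); apply: eq_bigr => i _.
by rewrite (formZl formP) form_t.
Qed.

Lemma t_sum_mem (c : 'I_l -> F) : H (\sum_i c i *: tvec form H (ad i)).
Proof.
by apply: (subspace_sum subH) => i _; apply: (subspaceZ subH); apply: t_mem.
Qed.

Lemma orth_roots_vec a v : H v -> (forall x, H x -> a x = form v x) ->
  orth_roots br form H a <-> orth br form H v.
Proof.
move=> Hv av; have la := lin_on_ext subH av (@form_lin_on _ _ _ _ H formP v).
by rewrite -(tvec_eq formP subH fdH ndH Hv av); apply: orth_roots_orth.
Qed.

Lemma class_T_base_data : base_data br form H t.
Proof.
have [rad [ind coord]] := base; split.
- by move=> i; apply: (is_root_rt formP).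
- move=> k ok; apply/rowP => i; rewrite mxE.
  have : (k 0 i)%:~R = 0 :> rat.
    apply: (ind (fun i => (k 0 i)%:~R)).
    apply/(orth_roots_vec (v := vec t k)) => //; first exact: t_sum_mem.
    move=> x Hx; rewrite form_t_sum //; apply: eq_bigr => j _.
    by rewrite ratr_int.
  by move/eqP; rewrite intr_eq0 => /eqP.
- move=> r rr; have [k [sk ok]] := coord _ (rt_is_root formP rr).
  exists (\row_i k i); split.
    by case: sk => sk; [left|right] => i; rewrite !mxE ?oppr_ge0.
  apply/(orth_roots_vec (a := fun x => form r x - \sum_(i < l) (k i)%:~R * ad i x)) => //.
    by apply: (subspaceB subH); [case: rr | apply: t_sum_mem].
  move=> x Hx; rewrite (formBl formP) form_t_sum //; congr (_ - _).
  by apply: eq_bigr => i _; rewrite mxE.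
Qed.

Let BD := class_T_base_data.

(** R-dot has rational coefficients, the root in its class integral coordinates; the two
    combinations differ by a radical element, and [gram_nondeg] makes them equal. *)
Lemma in_RdotP a : in_Rdot br form H ad a <->
  exists k r, [/\ rt br form H r, orth br form H (r - vec t k) &
                  forall x, H x -> a x = form (vec t k) x].
Proof.
split=> [[[c Ec] [b [rb ob]]]|[k [r [rr ok ak]]]]; last first.
  split.
    exists (fun i => (k 0 i)%:~R) => x Hx; rewrite ak // form_t_sum //.
    by apply: eq_bigr => i _; rewrite ratr_int.
  exists (form r); split; first exact: (rt_is_root formP).
  apply/(orth_roots_vec (v := r - vec t k)) => //.
    by apply: (subspaceB subH); [case: rr | apply: t_sum_mem].
  by move=> x Hx; rewrite ak // (formBl formP).
pose v := \sum_i ratr (c i) *: tvec form H (ad i).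
have Hv : H v by apply: t_sum_mem.
have rr := is_root_rt formP subH fdH ndH rb.
have [Hr Er] := tvecP formP subH fdH ndH rb.1.
have ov : orth br form H (tvec form H b - v).
  apply/(orth_roots_vec (a := fun x => b x - a x)) => //.
    exact: (subspaceB subH).
  by move=> x Hx; rewrite (formBl formP) Er // Ec // form_t_sum.
have [k [_ ok]] := bd_coord BD rr; exists k, (tvec form H b); split=> //.
have Ek j : \sum_i (ratr (c i) - (k 0 i)%:~R) * form (t i) (t j) = 0.
  have := subspaceB (subspace_orth RD) ok ov.
  rewrite opprB addrC addrA subrK => /(_ _ (bd_rt BD j)).
  rewrite (formBl formP) !(form_suml formP) -sumrB => E.
  rewrite -[RHS]E; apply: eq_bigr => i _.
  by rewrite !(formZl formP) mulrBl.
move=> x Hx; rewrite Ec // form_t_sum //; apply: eq_bigr => i _; congr (_ * _).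
by apply/eqP; rewrite -subr_eq0 (gram_nondeg RD BD Ek).
Qed.

(** The reduced system consists of 0 and the non-doubles of [Phi]. K will be the Cartan subalgebra
    of g, the only place where weights of g are compared. *)
Lemma in_Rdot_redP (K : L -> Prop) (b : L -> F) : (forall x, K x -> H x) ->
  (exists a, in_Rdot_red br form H ad a /\ forall x, K x -> b x = a x) <->
  (forall x, K x -> b x = 0) \/
  exists k, [/\ Phi br form H t k, forall k', Phi br form H t k' -> k <> k' + k' &
                forall x, K x -> b x = form (vec t k) x].
Proof.
have two := twoF_neq0 (rd_char RD).
have half (y : F) : (y + y) / 2 = y by rewrite -mulr2n -[y *+ 2]mulr_natr mulfK.
move=> KH; split=> [[a [[a0|[Ra nRa]] ba]]|[b0|[k [Pk nk bk]]]].
- by left=> x Kx; rewrite ba // a0 //; apply: KH.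
- have [k [r [rr ok ak]]] := (in_RdotP a).1 Ra.
  have [k0|k0] := eqVneq k 0.
    by left=> x Kx; rewrite ba // ak ?k0 ?vec0 ?(form0l formP) //; apply: KH.
  right; exists k; split; first exact: (rt_Phi RD BD rr ok k0).
    move=> k' [r' [rr' _ ok']] kk; apply: nRa; apply/in_RdotP; exists k', r'; split=> //.
    by move=> x Hx; rewrite ak // kk vecD (formDl formP) half.
  by move=> x Kx; rewrite ba // ak //; apply: KH.
- by exists (fun=> 0); split=> //; left.
- have [r [rr nr ok]] := Pk; exists (form (vec t k)); split=> //; right; split.
    by apply/in_RdotP; exists k, r.
  move=> /in_RdotP [k' [r' [rr' ok' hk']]].
  have kk : k = k' + k'.
    apply: (vec_inj RD BD); rewrite vecD.
    apply: (form_inj_on formP subH ndH).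
    - exact: t_sum_mem.
    - by apply: (subspaceD subH); apply: t_sum_mem.
    - by move=> x Hx; rewrite (formDl formP) -hk' // -mulrDl half.
  apply: (nk k') => //; apply: (rt_Phi RD BD rr' ok').
  by apply: contraNneq (Phi_neq0 RD BD Pk) => k0; rewrite kk k0 addr0.
Qed.

End ClassT.

Theorem theorem2p4 (F : fieldType) (L : lmodType F) (br : L -> L -> L)
  (form : L -> L -> F) (H : L -> Prop) :
  class_T br form H ->
  (exists alpha0, Rx br form H alpha0 /\ rform form H alpha0 alpha0 = 1) ->
  forall (l : nat) (ad : 'I_l -> L -> F), std_base br form H ad ->
  forall ep em : 'I_l -> L, std_e br form H ad ep em ->
  let g := gen_subalg br (fun x => exists i, x = ep i \/ x = em i) in
  let hd := fun x => exists c : 'I_l -> F,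
              x = \sum_(i < l) c i *: hcor form H (ad i) in
  (forall x, g x -> core br form H x) /\
  fin_dim g /\
  simple_lie br g /\
  (forall c : 'I_l -> F, \sum_(i < l) c i *: hcor form H (ad i) = 0 ->
      forall i, c i = 0) /\
  splitting_cartan br hd g /\
  (forall beta : L -> F,
      (exists y, y <> 0 /\ wsp br hd g beta y) <->
      (exists alpha, in_Rdot_red br form H ad alpha /\
                     forall h, hd h -> beta h = alpha h)).
Proof.
move=> T [a0 [[ra0 na0] _]] l ad base ep em chev g hd.
have formP := class_T_form T; have subH := class_T_sub T.
have fdH := class_T_fin_dim T; have ndH := class_T_nondeg T.
have RD := class_T_root_data T; have BD := class_T_base_data T base.
pose t i := tvec form H (ad i).
have epP i : wt br form H (t i) (ep i).
  by case: (chev i) => we _; apply: (wsp_wt formP subH fdH ndH) we; apply: ad_lin base i.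
have emP i : wt br form H (- t i) (em i).
  case: (chev i) => _ [[_ wf] _] h Hh.
  by rewrite wf // (formNl formP) (form_t T base).
(* [hcor] at [ad i] is convertible to [coroot] at [t i]. *)
have epem i : br (ep i) (em i) = coroot form (t i) by case: (chev i) => _ [_ [_ []]].
(* With an empty base the nonisotropic root a0 would have coordinates 0 and lie in the radical. *)
have [i0 _] : exists i : 'I_l, True.
  have rr := is_root_rt formP subH fdH ndH ra0; have [k [_ ok]] := bd_coord BD rr.
  have k0 : k != 0.
    apply/eqP => k0; apply: na0; move: ok; rewrite k0 vec0 subr0; exact.
  apply: NNPP => no; case/eqP: k0; apply/rowP => i; case: no; by exists i.
have hdH x : hd x -> H x := @cartan_mem _ _ _ _ _ _ _ RD BD x.
split.
  move=> x gx K sK coreK; apply: (gx K sK) => y [i yE]; apply: coreK.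
  have [we [wf _]] := chev i.
  have nt := t_noniso RD BD (i := i).
  case: yE => ->; first by exists (ad i); split=> //; split=> //; apply: base.1.
  (* For f_i the root is the opposite of [ad i], represented by -t_i and so nonisotropic as well. *)
  exists (fun z => - ad i z); split=> //; split.
    split; first by move=> c u v Hu Hv; rewrite (ad_lin base i) // opprD mulrN.
    by exists (em i); split=> //; apply: (em_neq0 RD BD epem).
  have -> : rform form H (fun z => - ad i z) (fun z => - ad i z) = form (- t i) (- t i).
    have tN : tvec form H (fun z => - ad i z) = - t i.
      apply: (tvec_eq formP subH fdH ndH).
        by apply: (subspaceN subH); apply: (t_mem T base).
      by move=> x' Hx; rewrite (formNl formP) (form_t T base).
    by rewrite /rform tN.
  by rewrite (formNl formP) (formNr formP) opprK.
split; first exact: (chev_fin_dim RD BD epP emP epem).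
split; first exact: (chev_simple RD BD epP emP epem i0 (class_T_irr T)).
split; first exact: (h_independent RD BD).
split.
  split; first exact: (chev_toral RD BD epP emP epem i0).
  split; first exact: (cartan_nilpotent RD BD epP emP epem).
  exact: (chev_self_normalizing RD BD epP emP epem).
move=> b; rewrite (in_Rdot_redP T base b hdH) (chev_weights RD BD epP emP epem i0 b).
(* It remains to match the elements of [Phi] that carry a vector of g with those that are not
   doubles. *)
split=> [] [b0|[k [Pk ex bk]]]; try by left.
  right; exists k; split=> // k' _; exact: (chev_reduced RD BD epP emP epem Pk ex).
right; exists k; split=> //.
have [[k' Pk' kk]|//] := chev_root_or_double RD BD epP emP epem Pk.
by case: (ex k').
Qed.
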